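(* If $G$ is an unbreakable 3-cyclic digraph, then $G$ is 3-annular if and only if it contains (as a subdigraph, up to isomorphism) no diwheel and none of the four branchers.
   Context: A digraph is a finite directed graph without loops or parallel edges (directed cycles of length two are permitted); $uv$ denotes an edge from $u$ to $v$. A digraph is 3-cyclic if all its directed cycles have length three. For a digraph $G$ (without directed cycles of length two), $G^-$ is the undirected graph with vertex set $V(G)$ in which distinct $u,v$ are adjacent if and only if $uv\in E(G)$ or $vu\in E(G)$. A non-null digraph is strongly connected if for every two vertices $u,v$ there is a directed path from $u$ to $v$; it is weakly 2-connected if $G^-$ is 2-connected (at least three vertices, connected, no cutvertex). $G$ is unbreakable if it is strongly connected and weakly 2-connected. A 3-ring of $G$ is an ordered partition $(A_1,A_2,A_3)$ of $V(G)$ such that for every edge $uv$ of $G$ there exists $i\in\{1,2,3\}$ with $u\in A_i$ and $v\in A_{i+1}$ (subscripts modulo 3). $G$ is 3-annular if it has a 3-ring $(A_1,A_2,A_3)$ such that $G$ can be drawn without crossings in the plane $\mathbb{R}^2$ so that, for $1\le i\le 3$, the vertices in $A_i$ are represented by points in the half-line $\{(r\cos(2\pi i/3), r\sin(2\pi i/3)): r>0\}$, and the edges from $A_{i-1}$ to $A_i$ (where $A_0=A_3$) are drawn within $\{(r\cos\theta,r\sin\theta): r>0,\ 2\pi(i-1)/3\le\theta\le 2\pi i/3\}$. A tricycle is a directed cycle of length three. A diwheel is a digraph obtained as follows: take an undirected graph consisting of a cycle $C$ of even length (at least four) and an extra vertex $v$ (the hub) adjacent to every vertex of $C$, and direct its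 edges so that for every edge of $C$, that edge together with $v$ forms a tricycle. The four branchers are the following two digraphs, each with eight vertices $x,y,a_1,a_2,a_3,b_1,b_2,b_3$, together with the two digraphs obtained from them by reversing the direction of all edges. First digraph: edges $xy$, and $ya_i,\ a_ix,\ a_ib_i,\ b_iy$ for $i=1,2,3$. Second digraph: edges $xy$; $ya_i,\ a_ix$ for $i=1,2,3$; $a_ib_i,\ b_iy$ for $i=1,2$; and $xb_3,\ b_3a_3$. *)

(* Defs.v *)
(* MathComp / MathComp-Analysis. *)
From mathcomp Require Import all_boot all_order all_algebra.
From mathcomp Require Import classical_sets set_interval reals topology.
From mathcomp Require Import normedtype trigo.

Set Implicit Arguments.
Unset Strict Implicit.
Unset Printing Implicit Defensive.

Import Order.TTheory GRing.Theory Num.Theory.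
Import numFieldNormedType.Exports.

Local Open Scope ring_scope.

Record digraph := Digraph {
  vertex :> finType;
  edge : rel vertex;
  edge_irr : irreflexive edge
}.

Arguments edge {d} _ _.

Definition three_cyclic (G : digraph) : Prop :=
  forall c : seq G, c != [::] -> ucycle edge c -> size c = 3%N.

(* The adjacency relation of G^-. *)
Definition underlying (G : digraph) : rel G :=
  fun u v => (u != v) && (edge u v || edge v u).

Definition strongly_connected (G : digraph) : Prop :=
  (0 < #|G|)%N /\ forall u v : G, connect edge u v.

(* In an undirected graph e, deleting v separates two vertices that e connects. *)
Definition cutvertex (T : finType) (e : rel T) (v : T) : Prop :=
  exists u w : T,
    [/\ u != v, w != v, connect e u w &
        ~~ connect (fun x y => [&& e x y, x != v & y != v]) u w].

Definition two_connected (T : finType) (e : rel T) : Prop :=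
  [/\ (3 <= #|T|)%N,
      forall u v : T, connect e u v &
      forall v : T, ~ cutvertex e v].

Definition weakly_2_connected (G : digraph) : Prop :=
  two_connected (@underlying G).

Definition unbreakable (G : digraph) : Prop :=
  strongly_connected G /\ weakly_2_connected G.

(* H is isomorphic to a (not necessarily induced) subdigraph of G. *)
Definition contains (G H : digraph) : Prop :=
  exists f : H -> G, injective f /\ forall x y, edge x y -> edge (f x) (f y).

(* The parts are indexed modulo 3, so A 0 stands for A_3. *)
Definition three_ring (G : digraph) (A : 'Z_3 -> {set G}) : Prop :=
  (forall v : G, exists! i, v \in A i) /\
  (forall u v : G, edge u v -> exists i, u \in A i /\ v \in A (i + 1)).

Section Drawing.
Local Open Scope classical_set_scope.

Definition half_line (R : realType) (theta : R) : set (R * R) :=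
  [set q | exists2 r : R, 0 < r & q = (r * cos theta, r * sin theta)].

Definition sector (R : realType) (alpha beta : R) : set (R * R) :=
  [set q | exists2 theta : R, alpha <= theta <= beta & half_line theta q].

(* [pt v] is the point representing v, and the restriction of [gamma u v] to
   [0, 1] is a simple arc representing the edge uv; the values of [gamma] at
   pairs that are not edges are irrelevant. *)
Record plane_drawing (R : realType) (G : digraph)
    (pt : G -> R * R) (gamma : G -> G -> R -> R * R) : Prop := PlaneDrawing {
  drawing_pt_inj : injective pt;
  drawing_continuous : forall u v : G, edge u v ->
    {within `[0, 1], continuous (gamma u v)};
  drawing_simple : forall u v : G, edge u v ->
    forall s t : R, 0 <= s <= 1 -> 0 <= t <= 1 ->
      gamma u v s = gamma u v t -> s = t;
  drawing_ends : forall u v : G, edge u v ->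
    gamma u v 0 = pt u /\ gamma u v 1 = pt v;
  drawing_avoids : forall u v w : G, edge u v ->
    forall t : R, 0 < t < 1 -> gamma u v t <> pt w;
  drawing_noncrossing : forall u v u' v' : G,
    edge u v -> edge u' v' -> (u, v) <> (u', v') ->
    forall s t : R, 0 < s < 1 -> 0 < t < 1 ->
      gamma u v s <> gamma u' v' t
}.

Definition angle (R : realType) (k : nat) : R := 2 * pi * k%:R / 3.

(* For i = 0, 1, 2, the edges from A i to A (i + 1) lie in the sector from
   angle 2 pi i / 3 to angle 2 pi (i + 1) / 3. *)
Definition three_annular (R : realType) (G : digraph) : Prop :=
  exists A : 'Z_3 -> {set G}, three_ring A /\
  exists (pt : G -> R * R) (gamma : G -> G -> R -> R * R),
  [/\ plane_drawing pt gamma,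
      forall (i : 'Z_3) (v : G), v \in A i -> half_line (angle R i) (pt v) &
      forall (i : 'Z_3) (u v : G), u \in A i -> v \in A (i + 1) -> edge u v ->
        forall t : R, 0 <= t <= 1 ->
          sector (angle R i) (angle R i.+1) (gamma u v t)].

End Drawing.

Definition forms_tricycle (G : digraph) (x y z : G) : bool :=
  ucycleb edge [:: x; y; z] || ucycleb edge [:: x; z; y].

Definition wheel_adj (T : eqType) (v : T) (c : seq T) : rel T := fun x y =>
  [|| (x == v) && (y \in c), (y == v) && (x \in c) |
      [&& x \in c, y \in c & (y == next c x) || (x == next c y)]].

(* Together, the third and fourth conditions say that each edge of the wheel
   with hub v and rim c is given exactly one of its two directions. *)
Definition is_diwheel (H : digraph) : Prop :=
  exists (v : H) (c : seq H),
  [/\ (4 <= size c)%N && ~~ odd (size c),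
      uniq (v :: c) /\ (forall x, x \in v :: c),
      forall x y : H, edge x y || edge y x = wheel_adj v c x y,
      forall x y : H, ~~ (edge x y && edge y x) &
      forall x : H, x \in c -> forms_tricycle x (next c x) v].

Definition reverse (G : digraph) : digraph :=
  @Digraph G (fun u v => edge v u) (@edge_irr G).

Definition list_edge (n : nat) (s : seq (nat * nat)) : rel 'I_n :=
  fun u v => (val u, val v) \in s.

(* Vertex numbering of the branchers: x = 0, y = 1, a_i = 1 + i, b_i = 4 + i. *)
Definition brancher1_edges : seq (nat * nat) :=
  let x := 0%N in let y := 1%N in
  let a i := (1 + i)%N in let b i := (4 + i)%N in
  (x, y) ::
  flatten [seq [:: (y, a i); (a i, x); (a i, b i); (b i, y)] | i <- [:: 1; 2; 3]%N].

Definition brancher2_edges : seq (nat * nat) :=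
  let x := 0%N in let y := 1%N in
  let a i := (1 + i)%N in let b i := (4 + i)%N in
  (x, y) ::
  flatten [seq [:: (y, a i); (a i, x)] | i <- [:: 1; 2; 3]%N] ++
  flatten [seq [:: (a i, b i); (b i, y)] | i <- [:: 1; 2]%N] ++
  [:: (x, b 3%N); (b 3%N, a 3%N)].

Lemma brancher1_irr : irreflexive (@list_edge 8 brancher1_edges).
Proof. by case; do 8?[case=> //]. Qed.

Lemma brancher2_irr : irreflexive (@list_edge 8 brancher2_edges).
Proof. by case; do 8?[case=> //]. Qed.

Definition brancher1 : digraph := Digraph brancher1_irr.
Definition brancher2 : digraph := Digraph brancher2_irr.

Definition is_brancher (H : digraph) : Prop :=
  [\/ H = brancher1, H = brancher2, H = reverse brancher1 | H = reverse brancher2].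

(* Main.v *)
(* A drawing of the required kind orders every part A_i by the distance to the
   origin, and edges from A_i to A_(i+1) do not cross; this is [annular_order].
   That crossing end points force two arcs in a sector to meet is shown in the
   coordinates of the sector, in which both arcs run from the left to the right
   side of a strip, by a parity argument on a fine grid.  Conversely such an
   order gives a drawing by arcs on which angle and radius are affine.

   Diwheels and branchers have no such order.  For the converse, the vertices
   of an unbreakable 3-cyclic digraph G are coloured modulo 3 by the distance
   from a root, and one takes a longest sequence of tricycles (a [strip]) in
   which each tricycle arises from the preceding one by replacing one vertex by
   a new one.  Let a tricycle T share an edge with the strip.  If its third
   vertex lies on the strip, then T is covered by the edges of the strip, or a
   link closes up to a diwheel, or there is a directed cycle of length six.  If
   its third vertex is new, then the strip can be made longer, or a brancher or
   a directed cycle of length six appears.  So the edges of the strip form a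
   subdigraph closed under tricycles.  An ear attached to it would close up to a
   directed cycle, that is to a tricycle, so there are no ears, and by weak
   2-connectivity the strip covers G.  Its order is the one required. *)
Require Import Defs.
From mathcomp Require Import all_boot all_order all_algebra.
From mathcomp Require Import zify ring lra.
From mathcomp Require Import boolp classical_sets reals topology.
From mathcomp Require Import normedtype derive trigo.

Set Implicit Arguments.
Unset Strict Implicit.
Unset Printing Implicit Defensive.

Import Order.TTheory GRing.Theory Num.Theory.
Import numFieldNormedType.Exports.

Local Open Scope ring_scope.

(** * Crossing curves *)

(* In [grid_crossing], a door is a grid edge across which the difference of the
   two abscissas changes sign while the difference of the ordinates is negative;
   [h] and [v] mark the horizontal and the vertical doors. *)
Lemma door_parity (N : nat) (h v : nat -> nat -> bool) :
  (forall i j, (i < N)%N -> (j < N)%N ->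
    h i j (+) h i j.+1 = v i j (+) v i.+1 j) ->
  (forall i, (i < N)%N -> h i 0%N = false) ->
  (forall i, (i < N)%N -> h i N = false) ->
  \big[addb/false]_(j < N) v 0%N j = \big[addb/false]_(j < N) v N j.
Proof.
move=> cell h0 hN.
(* Summed over a column of cells, the horizontal doors telescope to the two outermost ones. *)
have column i : (i < N)%N -> forall n, (n <= N)%N ->
    \big[addb/false]_(j < n) v i j (+) \big[addb/false]_(j < n) v i.+1 j
    = h i 0%N (+) h i n.
  move=> iN; elim=> [|n IH] nN; first by rewrite !big_ord0 !addbb.
  rewrite !big_ord_recr /= addbACA (IH (ltnW nN)) -cell //.
  by rewrite addbA -(addbA (h i 0%N)) addbb addbF.
have {column} column i : (i < N)%N ->
    \big[addb/false]_(j < N) v i j = \big[addb/false]_(j < N) v i.+1 j.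
  move=> iN; have := column i iN N (leqnn N); rewrite h0 // hN //=.
  by do 2 case: (\big[_/_]_(_ < _) _).
have : forall i, (i <= N)%N ->
    \big[addb/false]_(j < N) v 0%N j = \big[addb/false]_(j < N) v i j.
  by elim=> [|i IH] iN //; rewrite (IH (ltnW iN)) column.
by move=> /(_ N (leqnn N)).
Qed.

(** A change of label puts zero between [X] and [X'], so [X] is small. Then [Y] must be at least
    [4 * e] in absolute value, too far from zero for a step below [2 * e] to alter its sign. *)
Lemma door_sign (R : realFieldType) (e X X' Y Y' : R) (b b' : bool) :
  (if b then 0 <= X else X <= 0) -> (if b' then 0 <= X' else X' <= 0) ->
  b != b' -> `|X' - X| < 2 * e -> `|Y' - Y| < 2 * e ->
  ~ (`|X| < 4 * e /\ `|Y| < 4 * e) -> (Y' < 0) = (Y < 0).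
Proof.
move=> hb hb' bb' dX dY nz.
have Xe : `|X| < 2 * e.
  move: dX; rewrite !ltr_norml.
  by case: b b' hb hb' bb' => [] [] // hb hb' _ /andP[? ?]; apply/andP; split; lra.
have e0 : 0 < e by have := normr_ge0 X; lra.
have Y4 : 4 * e <= `|Y|.
  by rewrite leNgt; apply/negP => Y4; apply: nz; split=> //; lra.
move: dY; rewrite ltr_norml => /andP[dY1 dY2].
move: Y4; case: (ltrP Y 0) => Ys; [rewrite ltr0_norm // | rewrite ger0_norm //] => Y4.
  by lra.
by apply/negbTE; rewrite -leNgt; lra.
Qed.

(** If no grid point had both differences small, every cell would have an even number of doors. But
    the side [i = 0] has exactly one door, at [j = 0], the side [i = N] has none, and the other two
    sides have none either, against [door_parity]. *)
Lemma grid_crossing (R : realFieldType) (N : nat) (e : R)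
    (fx fy gx gy : nat -> R) :
  (0 < N)%N ->
  (forall i, (i < N)%N -> [/\ `|fx i.+1 - fx i| < e, `|fy i.+1 - fy i| < e,
     `|gx i.+1 - gx i| < e & `|gy i.+1 - gy i| < e]) ->
  (forall i, (i <= N)%N -> 0 <= fx i <= 1 /\ 0 <= gx i <= 1) ->
  fx 0%N = 0 -> fx N = 1 -> gx 0%N = 0 -> gx N = 1 ->
  fy 0%N < gy 0%N -> gy N < fy N ->
  exists i j, [/\ (i <= N)%N, (j <= N)%N, `|fx i - gx j| < 4 * e &
    `|fy i - gy j| < 4 * e].
Proof.
move=> N0 osc bnd fx0 fxN gx0 gxN start stop; apply: contrapT => none.
pose X i j := fx i - gx j; pose Y i j := fy i - gy j.
have nz i j : (i <= N)%N -> (j <= N)%N -> ~ (`|X i j| < 4 * e /\ `|Y i j| < 4 * e).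
  by move=> iN jN [? ?]; apply: none; exists i, j.
(* The label of [X i j], with its value forced on the boundary, where [X] may
   vanish; then the only doors of the boundary lie next to two of its corners. *)
pose P i j : bool :=
  (j == 0%N) || (i == N) || ((i != 0%N) && (j != N) && (0 <= X i j)).
have PX i j : (i <= N)%N -> (j <= N)%N ->
    if P i j then 0 <= X i j else X i j <= 0.
  move=> iN jN; have [/andP[? ?] _] := bnd i iN; have [_ /andP[? ?]] := bnd j jN.
  rewrite /P /X; case: eqVneq => [-> /=|_ /=]; first by rewrite gx0; lra.
  case: eqVneq => [-> /=|_ /=]; first by rewrite fxN; lra.
  case: eqVneq => [-> /=|_ /=]; first by rewrite fx0; lra.
  case: eqVneq => [-> /=|_ /=]; first by rewrite gxN; lra.
  by case: ifP => // /negbT; rewrite -ltNge => /ltW.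
have near i j i' j' : (i < N)%N -> (j < N)%N -> (i <= i' <= i.+1)%N ->
    (j <= j' <= j.+1)%N -> forall i'' j'', (i <= i'' <= i.+1)%N ->
    (j <= j'' <= j.+1)%N ->
    `|X i' j' - X i'' j''| < 2 * e /\ `|Y i' j' - Y i'' j''| < 2 * e.
  have close (k k' k'' : nat) (f : nat -> R) :
      (k <= k' <= k.+1)%N -> (k <= k'' <= k.+1)%N ->
      `|f k.+1 - f k| < e -> `|f k' - f k''| < e.
    move=> /andP[k1 k2] /andP[k3 k4] fk.
    have e0 : 0 < e by apply: le_lt_trans fk.
    move: k2; rewrite leq_eqVlt ltnS => /orP[/eqP->|k2];
      move: k4; rewrite leq_eqVlt ltnS => /orP[/eqP->|k4];
      rewrite ?subrr ?normr0 //.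
    - by have <- : k = k'' by [apply/eqP; rewrite eqn_leq k3].
    - by have <- : k = k' by [apply/eqP; rewrite eqn_leq k1]; rewrite distrC.
    - have <- : k = k'' by [apply/eqP; rewrite eqn_leq k3].
      have <- : k = k' by [apply/eqP; rewrite eqn_leq k1].
      by rewrite subrr normr0.
  move=> iN jN hi' hj' i'' j'' hi'' hj''.
  have [fx1 fy1 _ _] := osc i iN; have [_ _ gx1 gy1] := osc j jN.
  rewrite /X /Y !opprB !addrA.
  have tri (a b c d : R) : `|a - b| < e -> `|c - d| < e ->
      `|a - c + d - b| < 2 * e.
    by rewrite !ltr_norml => /andP[? ?] /andP[? ?]; apply/andP; split; lra.
  by split; apply: tri; apply: close; eassumption.
pose h i j := (P i j != P i.+1 j) && (Y i j < 0).
pose v i j := (P i j != P i j.+1) && (Y i j < 0).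
have cell i j : (i < N)%N -> (j < N)%N ->
    h i j (+) h i j.+1 = v i j (+) v i.+1 j.
  move=> iN jN; have := near i j _ _ iN jN; rewrite /h /v.
  set i' := i.+1; set j' := j.+1 => nr.
  have ii : (i <= i <= i')%N by rewrite leqnn leqnSn.
  have ii' : (i <= i' <= i')%N by rewrite leqnn leqnSn.
  have jj : (j <= j <= j')%N by rewrite leqnn leqnSn.
  have jj' : (j <= j' <= j')%N by rewrite leqnn leqnSn.
  (* In a cell whose labels are not constant, [Y] has the same sign at all corners. The parity of
     its doors is then that of the label changes around a square, which is even. *)
  have sgn a b c d : (i <= a <= i')%N -> (j <= b <= j')%N ->
      (i <= c <= i')%N -> (j <= d <= j')%N -> P a b != P c d ->
      (Y i j < 0) = (Y a b < 0).
    move=> ha hb hc hd Pne.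
    have aN : (a <= N)%N by case/andP: ha => _ ha; apply: leq_trans ha iN.
    have bN : (b <= N)%N by case/andP: hb => _ hb; apply: leq_trans hb jN.
    have cN : (c <= N)%N by case/andP: hc => _ hc; apply: leq_trans hc iN.
    have dN : (d <= N)%N by case/andP: hd => _ hd; apply: leq_trans hd jN.
    apply: (door_sign (PX a b aN bN) (PX c d cN dN) Pne); last exact: nz.
      by have [] := nr c d hc hd a b ha hb.
    by have [] := nr i j ii jj a b ha hb.
  have s1 : (P i j' != P i' j') -> (Y i j < 0) = (Y i j' < 0) by apply: sgn.
  have s2 : (P i' j != P i' j') -> (Y i j < 0) = (Y i' j < 0) by apply: sgn.
  move: s1 s2; case: (P i j); case: (P i' j); case: (P i j'); case: (P i' j') => /=;
    do 2?[move=> /(_ isT) -> | move=> _]; by case: (Y _ _ < 0); rewrite ?addbb.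
have hor0 i : (i < N)%N -> h i 0%N = false by move=> iN; rewrite /h /P /=.
(* At the corner [(N, N)] the difference [X] vanishes, so [Y] is large there. This excludes the only
   edge of the row [j = N] on which the label changes. *)
have YN : 4 * e <= Y N N.
  rewrite leNgt; apply/negP => YNe; apply: (nz N N) => //.
  rewrite /X fxN gxN subrr normr0; move: YNe; rewrite /Y.
  rewrite ger0_norm; last by rewrite subr_ge0 ltW.
  by move=> YNe; split=> //; apply: le_lt_trans YNe; rewrite subr_ge0 ltW.
have horN i : (i < N)%N -> h i N = false.
  move=> iN; rewrite /h /P eqxx (gtn_eqF N0) (ltn_eqF iN) !andbF.
  have [iN1|//] := eqVneq i.+1 N.
  apply/negbTE; rewrite -leNgt.
  have jN : (N.-1 < N)%N by rewrite prednK.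
  have hi1 : (i <= N <= i.+1)%N by rewrite iN1 leqnn ltnW.
  have hi2 : (i <= i <= i.+1)%N by rewrite leqnn leqnSn.
  have hj : (N.-1 <= N <= N.-1.+1)%N by rewrite prednK // leq_pred leqnn.
  have [_] := near i N.-1 N N iN jN hi1 hj i N hi2 hj.
  have [? _ _ _] := osc i iN; have := normr_ge0 (fx i.+1 - fx i).
  by rewrite ltr_norml => ? /andP[_ ?]; lra.
have := door_parity cell hor0 horN.
rewrite [RHS]big1 => [|j _]; last by rewrite /v /P eqxx !orbT.
rewrite -(big_mkord xpredT (v 0%N)) big_ltn // big_nat big1 => [|j /andP[j0 _]].
  by rewrite /v /P eqxx /Y subr_lt0 start (ltn_eqF N0).
by rewrite /v /P !eqxx (ltn_eqF N0) (gtn_eqF j0).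
Qed.

(** * From the grid to continuous curves *)

Section ContinuousCrossing.
Local Open Scope classical_set_scope.
Variable R : realType.

(** Serves twice: for the modulus of uniform continuity, and for the pair of parameters at which two
    curves are closest. *)
Lemma unit_square_min (h : R * R -> R) (C : set (R * R)) :
  continuous h -> closed C ->
  (`[0, 1] `*` `[0, 1]) `&` C !=set0 ->
  exists p, [/\ 0 <= p.1 <= 1, 0 <= p.2 <= 1, C p &
    forall q, 0 <= q.1 <= 1 -> 0 <= q.2 <= 1 -> C q -> h p <= h q].
Proof.
move=> ch cC ne.
have K : compact ((`[0, 1] `*` `[0, 1] : set (R * R)) `&` C).
  apply: compact_closedI => //.
  by apply: compact_setX; exact: segment_compact.
have [//|p] := @compact_EVT_min _ R h _ ne K.
  exact: continuous_subspaceT.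
rewrite inE => -[[]] /=; rewrite !in_itv /= => p1 p2 pC pmin.
exists p; split=> // q q1 q2 qC; apply: pmin; rewrite inE; split=> //.
Qed.

Lemma continuous_dist (f g : R -> R) : continuous f -> continuous g ->
  continuous (fun p : R * R => `|f p.1 - g p.2|).
Proof.
move=> cf cg p.
apply: (@continuous_comp _ _ _ (fun p : R * R => f p.1 - g p.2) Num.norm);
  last exact: norm_continuous.
apply: continuousB.
  by apply: (@continuous_comp _ _ _ fst f); [exact: cvg_fst|exact: cf].
by apply: (@continuous_comp _ _ _ snd g); [exact: cvg_snd|exact: cg].
Qed.

(** The pairs with [e <= |f s - f t|] form a closed set off the diagonal; [d] is the least [|s - t|]
    over it. *)
Lemma heine_unit_interval (f : R -> R) (e : R) : continuous f -> 0 < e ->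
  exists2 d, 0 < d & forall s t, 0 <= s <= 1 -> 0 <= t <= 1 ->
    `|s - t| < d -> `|f s - f t| < e.
Proof.
move=> cf e0; have cd := continuous_dist cf cf.
pose C := [set p : R * R | e <= `|f p.1 - f p.2|].
have cC : closed C.
  apply: (@closed_comp _ _ (fun p : R * R => `|f p.1 - f p.2|) [set x | e <= x]).
    by move=> p _; exact: cd.
  exact: closed_ge.
have [ne|none] := pselect ((`[0, 1] `*` `[0, 1]) `&` C !=set0); last first.
  exists 1 => // s t s01 t01 _; rewrite ltNge; apply/negP => est; apply: none.
  by exists (s, t); split => //; split; rewrite /= in_itv.
have cid : continuous (fun x : R => x) by move=> x; exact: cvg_id.
have [p [p1 p2 pC pmin]] :=
  unit_square_min (continuous_dist cid cid) cC ne.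
exists `|p.1 - p.2| => [|s t s01 t01]; last first.
  by rewrite !ltNge; apply: contra => est; exact: (pmin (s, t)).
rewrite normr_gt0 subr_eq0; apply/eqP => pE; move: pC.
by rewrite /C /= pE subrr normr0 leNgt e0.
Qed.

Lemma continuous_crossing (fx fy gx gy : R -> R) :
  continuous fx -> continuous fy -> continuous gx -> continuous gy ->
  (forall t, 0 <= t <= 1 -> 0 <= fx t <= 1 /\ 0 <= gx t <= 1) ->
  fx 0 = 0 -> fx 1 = 1 -> gx 0 = 0 -> gx 1 = 1 ->
  fy 0 < gy 0 -> gy 1 < fy 1 ->
  exists s t, [/\ 0 <= s <= 1, 0 <= t <= 1, fx s = gx t & fy s = gy t].
Proof.
move=> cfx cfy cgx cgy bnd fx0 fx1 gx0 gx1 start stop.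
pose h p := `|fx p.1 - gx p.2| + `|fy p.1 - gy p.2|.
have ch : continuous h.
  by move=> p; apply: cvgD; exact: continuous_dist.
have [|p [p1 p2 _ pmin]] := unit_square_min ch (@closedT _).
  by exists (0, 0); split=> //; split; rewrite /= in_itv /= lexx ler01.
exists p.1, p.2; suff hp : h p <= 0.
  split=> //; apply/eqP; rewrite -subr_eq0 -normr_le0; apply: le_trans hp.
    by rewrite lerDl.
  by rewrite lerDr.
rewrite leNgt; apply/negP => hp.
(* [grid_crossing] yields two differences below [4 * e], hence a value of [h] below [8 * e], which
   is its minimum. *)
pose e := h p / 8; have e0 : 0 < e by rewrite divr_gt0.
have [d1 d1_gt0 u1] := heine_unit_interval cfx e0.
have [d2 d2_gt0 u2] := heine_unit_interval cfy e0.
have [d3 d3_gt0 u3] := heine_unit_interval cgx e0.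
have [d4 d4_gt0 u4] := heine_unit_interval cgy e0.
pose d := Num.min (Num.min d1 d2) (Num.min d3 d4).
have d0 : 0 < d by rewrite !lt_min d1_gt0 d2_gt0 d3_gt0.
pose N := (Num.bound d^-1).+1.
have N0 : 0 < N%:R :> R by rewrite ltr0n.
have Nd : N%:R^-1 < d.
  rewrite -[ltRHS]invrK ltf_pV2 ?posrE ?invr_gt0 //.
  apply: lt_le_trans (archi_boundP _) _; first by rewrite invr_ge0 ltW.
  by rewrite ler_nat.
pose x (i : nat) : R := i%:R / N%:R.
have x0 : x 0%N = 0 by rewrite /x mul0r.
have xN : x N = 1 by rewrite /x divff // gt_eqF.
have x01 i : (i <= N)%N -> 0 <= x i <= 1.
  by move=> iN; rewrite divr_ge0 //= ler_pdivrMr // mul1r ler_nat.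
have xS i : `|x i.+1 - x i| < d.
  by rewrite /x -mulrBl -natrB // subSnn mul1r ger0_norm // invr_ge0.
have [||||||||| i [j [iN jN hx hy]]] := @grid_crossing R N e (fx \o x) (fy \o x) (gx \o x) (gy \o x).
- by [].
- move=> i iN; have := xS i; rewrite !lt_min => /andP[/andP[? ?] /andP[? ?]].
  by split; [apply: u1|apply: u2|apply: u3|apply: u4] => //; apply: x01; rewrite // ltnW.
- by move=> i iN; exact: bnd _ (x01 i iN).
- by rewrite /= x0.
- by rewrite /= xN.
- by rewrite /= x0.
- by rewrite /= xN.
- by rewrite /= x0.
- by rewrite /= xN.
have := pmin (x i, x j) (x01 _ iN) (x01 _ jN) I.
have -> : h p = 8 * e by rewrite /e; lra.
by move: hx hy; rewrite /h /=; lra.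
Qed.

End ContinuousCrossing.

Section Clamp.
Local Open Scope classical_set_scope.
Variable R : realType.

(** The arcs of a drawing are continuous only within the unit interval; composing with [clamp] makes
    them continuous on the whole line, as [continuous_crossing] requires. *)
Definition clamp (t : R) : R := Num.max 0 (Num.min t 1).

Lemma clamp_itv t : 0 <= clamp t <= 1.
Proof. by rewrite /clamp le_max lexx ge_max ler01 ge_min lexx orbT. Qed.

Lemma clamp_id t : 0 <= t <= 1 -> clamp t = t.
Proof. by case/andP=> t0 t1; rewrite /clamp (min_idPl t1) (max_idPr t0). Qed.

Lemma continuous_clamp : continuous clamp.
Proof.
move=> t; apply: (@continuous_max R R (fun=> 0) (fun s => Num.min s 1) t).
  exact: cvg_cst.
apply: (@continuous_min R R id (fun=> 1) t); first exact: cvg_id.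
exact: cvg_cst.
Qed.

Lemma continuous_comp_clamp (T : topologicalType) (f : R -> T) :
  {within `[0, 1], continuous f} -> continuous (f \o clamp).
Proof.
move=> cf x; have Ax : `[0, 1] (clamp x) by rewrite /= in_itv /= clamp_itv.
have h : f y @[y --> within `[0, 1] (nbhs (clamp x))] --> f (clamp x).
  by rewrite nbhs_subspace_in //; exact: cf.
apply: cvg_comp h => U wU.
change (nbhs x (fun y => U (clamp y))).
apply: (@filterS _ (nbhs x)) (continuous_clamp (x := x) wU) => y /=; apply.
by rewrite in_itv /= clamp_itv.
Qed.

End Clamp.

(** * Straightening a sector to a strip *)

Section SectorCoordinates.
Local Open Scope classical_set_scope.
Variable R : realType.
Implicit Types (q : R * R) (alpha beta : R).

(* Up to the factor sin (beta - alpha), the coordinates of q with respect to the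
   two directions that bound the sector. *)
Definition sector_fst beta q : R := q.1 * sin beta - q.2 * cos beta.
Definition sector_snd alpha q : R := q.2 * cos alpha - q.1 * sin alpha.

(** Cramer's rule, with determinant [sin (beta - alpha)]. *)
Lemma sector_coord_inj alpha beta q q' : sin (beta - alpha) != 0 ->
  sector_fst beta q = sector_fst beta q' ->
  sector_snd alpha q = sector_snd alpha q' -> q = q'.
Proof.
case: q q' => [x y] [x' y']; rewrite /sector_fst /sector_snd /= => D e1 e2.
have kill z : z * sin (beta - alpha) = 0 -> z = 0.
  by move/eqP; rewrite mulf_eq0 (negPf D) orbF => /eqP.
have ex : x - x' = 0.
  apply: kill; rewrite sinB.
  transitivity (cos alpha * ((x * sin beta - y * cos beta) - (x' * sin beta - y' * cos beta))
    + cos beta * ((y * cos alpha - x * sin alpha) - (y' * cos alpha - x' * sin alpha))).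
    by ring.
  by rewrite e1 e2 !subrr !mulr0 addr0.
have ey : y - y' = 0.
  apply: kill; rewrite sinB.
  transitivity (sin alpha * ((x * sin beta - y * cos beta) - (x' * sin beta - y' * cos beta))
    + sin beta * ((y * cos alpha - x * sin alpha) - (y' * cos alpha - x' * sin alpha))).
    by ring.
  by rewrite e1 e2 !subrr !mulr0 addr0.
by rewrite (subr0_eq ex) (subr0_eq ey).
Qed.

(** At radius [r] and angle [th] the coordinates are [r * sin (beta - th)] and
    [r * sin (th - alpha)]; both angles lie between 0 and [pi], and they do not vanish together. *)
Lemma sector_coord_ge0 alpha beta q : 0 < beta - alpha < pi ->
  sector alpha beta q ->
  [/\ 0 <= sector_fst beta q, 0 <= sector_snd alpha q &
      0 < sector_fst beta q + sector_snd alpha q].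
Proof.
move=> /andP[d0 dpi] [th /andP[th1 th2] [r r0 ->]]; rewrite /sector_fst /sector_snd /=.
have -> : r * cos th * sin beta - r * sin th * cos beta = r * sin (beta - th).
  by rewrite sinB; ring.
have -> : r * sin th * cos alpha - r * cos th * sin alpha = r * sin (th - alpha).
  by rewrite sinB; ring.
have s1 : 0 <= sin (beta - th) by apply: sin_ge0_pi; lra.
have s2 : 0 <= sin (th - alpha) by apply: sin_ge0_pi; lra.
split; [by rewrite mulr_ge0 // ltW|by rewrite mulr_ge0 // ltW|].
rewrite -mulrDr mulr_gt0 //.
have [tha|tha] := ltrP alpha th.
  have : 0 < sin (th - alpha) by apply: sin_gt0_pi; lra.
  by lra.
have : 0 < sin (beta - th) by apply: sin_gt0_pi; lra.
by lra.
Qed.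

(** With [A], [B] the two sector coordinates, [X = B / (A + B)] is 0 on the first side and 1 on the
    second, while [Y = A + B] is proportional to the radius on either side. As [X] and [Y] determine
    the point, [continuous_crossing] applies to them. *)
Lemma sector_crossing alpha beta (f g : R -> R * R) (u v u' v' : R) :
  0 < beta - alpha < pi ->
  {within `[0, 1], continuous f} -> {within `[0, 1]%classic, continuous g} ->
  (forall t, 0 <= t <= 1 -> sector alpha beta (f t)) ->
  (forall t, 0 <= t <= 1 -> sector alpha beta (g t)) ->
  f 0 = (u * cos alpha, u * sin alpha) -> f 1 = (v * cos beta, v * sin beta) ->
  g 0 = (u' * cos alpha, u' * sin alpha) -> g 1 = (v' * cos beta, v' * sin beta) ->
  0 < u < u' -> 0 < v' < v ->
  exists s t, [/\ 0 <= s <= 1, 0 <= t <= 1 & f s = g t].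
Proof.
move=> hd cf cg sf sg f0 f1 g0 g1 /andP[u0 uu'] /andP[v0 vv'].
have s0 : 0 < sin (beta - alpha) by exact: sin_gt0_pi.
pose A (h : R -> R * R) t := sector_fst beta (h (clamp t)).
pose B (h : R -> R * R) t := sector_snd alpha (h (clamp t)).
have cA (h : R -> R * R) : {within `[0, 1], continuous h} -> continuous (A h).
  move=> /continuous_comp_clamp ch t; rewrite /A /sector_fst.
  by apply: cvgB; (apply: cvgM; last exact: cvg_cst);
    apply: (continuous_comp (ch t)); [exact: cvg_fst|exact: cvg_snd].
have cB (h : R -> R * R) : {within `[0, 1], continuous h} -> continuous (B h).
  move=> /continuous_comp_clamp ch t; rewrite /B /sector_snd.
  by apply: cvgB; (apply: cvgM; last exact: cvg_cst);
    apply: (continuous_comp (ch t)); [exact: cvg_snd|exact: cvg_fst].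
pose X h t := B h t / (A h t + B h t); pose Y h t := A h t + B h t.
have pos h : (forall t, 0 <= t <= 1 -> sector alpha beta (h t)) ->
    forall t, [/\ 0 <= A h t, 0 <= B h t & 0 < Y h t].
  by move=> sh t; apply: sector_coord_ge0 => //; apply: sh; exact: clamp_itv.
have cY (h : R -> R * R) : {within `[0, 1], continuous h} -> continuous (Y h).
  by move=> ch t; apply: continuousD; [exact: cA|exact: cB].
have cX (h : R -> R * R) : (forall t, 0 <= t <= 1 -> sector alpha beta (h t)) ->
    {within `[0, 1], continuous h} -> continuous (X h).
  move=> sh ch t; apply: continuousM; first exact: cB.
  apply: continuousV; last exact: cY.
  by have [_ _ /gt_eqF->] := pos h sh t.
have X01 h : (forall t, 0 <= t <= 1 -> sector alpha beta (h t)) ->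
    forall t, 0 <= X h t <= 1.
  move=> sh t; have [A0 B0 Y0] := pos h sh t.
  rewrite /Y in Y0.
  apply/andP; split; first by apply: divr_ge0 => //; apply: ltW.
  by rewrite /X ler_pdivrMr // mul1r lerDr.
have start h w : h 0 = (w * cos alpha, w * sin alpha) ->
    X h 0 = 0 /\ Y h 0 = w * sin (beta - alpha).
  move=> h0; have c0 : clamp 0 = 0 :> R by rewrite clamp_id // lexx ler01.
  have B0 : B h 0 = 0 by rewrite /B c0 h0 /sector_snd /=; ring.
  rewrite /X B0 mul0r /Y B0 addr0 /A c0 h0 /sector_fst /= sinB; split=> //; ring.
have stop h w : 0 < w -> h 1 = (w * cos beta, w * sin beta) ->
    X h 1 = 1 /\ Y h 1 = w * sin (beta - alpha).
  move=> w0 h1; have c1 : clamp 1 = 1 :> R by rewrite clamp_id // lexx ler01.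
  have A0 : A h 1 = 0 by rewrite /A c1 h1 /sector_fst /=; ring.
  have B1 : B h 1 = w * sin (beta - alpha).
    by rewrite /B c1 h1 /sector_snd /= sinB; ring.
  rewrite /X /Y A0 add0r divff // B1 mulf_neq0 //; exact: lt0r_neq0.
have [Xf0 Yf0] := start f u f0; have [Xg0 Yg0] := start g u' g0.
have [Xf1 Yf1] := stop f v (lt_trans v0 vv') f1; have [Xg1 Yg1] := stop g v' v0 g1.
have [|||s [t [s01 t01 eX eY]]] := continuous_crossing (cX f sf cf) (cY f cf)
  (cX g sg cg) (cY g cg) _ Xf0 Xf1 Xg0 Xg1.
- by move=> t _; split; exact: X01.
- by rewrite Yf0 Yg0 ltr_pM2r.
- by rewrite Yf1 Yg1 ltr_pM2r.
exists s, t; split=> //.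
have [_ _ /lt0r_neq0 Yf] := pos f sf s; have [_ _ /lt0r_neq0 Yg] := pos g sg t.
have eB : B f s = B g t.
  by rewrite -[LHS](divfK Yf) -[RHS](divfK Yg) -/(X f s) -/(X g t) eX eY.
have eA : A f s = A g t by move: eY; rewrite /Y eB => /addIr.
rewrite -(clamp_id s01) -(clamp_id t01).
exact: (sector_coord_inj (lt0r_neq0 s0)).
Qed.

End SectorCoordinates.

(** * Drawings and orders *)

(** The conclusion of [ao_mono] is weak because the two edges may have the same head. *)
Record annular_order (R : numDomainType) (G : digraph) (col : G -> 'Z_3)
    (pos : G -> R) : Prop := AnnularOrder {
  ao_pos : forall v, 0 < pos v;
  ao_edge : forall u v : G, edge u v -> col v = col u + 1;
  ao_inj : forall u v, col u = col v -> pos u = pos v -> u = v;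
  ao_mono : forall u v u' v' : G, edge u v -> edge u' v' -> col u = col u' ->
    pos u < pos u' -> pos v <= pos v'
}.

Section Polar.
Variable R : realType.
Implicit Types (i : 'Z_3).

Definition polar (r theta : R) : R * R := (r * cos theta, r * sin theta).

(** The two angles differ only for the last index, where they are 0 and a full turn. *)
Lemma angle_next i : polar^~ (angle R (i + 1)%R) = polar^~ (angle R i.+1).
Proof.
apply/funext => r; case: i => [[|[|[|//]]] hi] //=.
rewrite /angle /polar /= mulr0 mul0r.
have -> : 2 * pi * 3 / 3 = 0 + pi *+ 2 :> R by rewrite mulr2n; lra.
by rewrite cosD2pi sinD2pi.
Qed.

Lemma angleS (k : nat) : angle R k.+1 = angle R k + angle R 1.
Proof. by rewrite /angle -(natr1 k); lra. Qed.

Lemma angle1_itv : 0 < angle R 1 < pi.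
Proof. by rewrite /angle; have := pi_gt0 R; lra. Qed.

(** From [cos x = 1 - 2 * sin (x / 2) ^ 2], where half of a positive [x] lies strictly between 0 and
    [pi]. *)
Lemma cos_eq1 (x : R) : `|x| < 2 * pi -> cos x = 1 -> x = 0.
Proof.
have key (y : R) : 0 < y < 2 * pi -> cos y <> 1.
  move=> y0 cy.
  have s0 : 0 < sin (y / 2) by apply: sin_gt0_pi; lra.
  have yE : y = y / 2 *+ 2 by rewrite mulr2n; lra.
  move: cy; rewrite yE cos_mulr2n cos2sin2 => cy.
  have : 0 < sin (y / 2) ^+ 2 by rewrite exprn_gt0.
  by rewrite mulr2n in cy; lra.
rewrite ltr_norml => /andP[x1 x2] cx.
case: (ltrgtP x 0) => // x0; last by case: (key x); rewrite ?x0 ?x2.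
by case: (key (- x)); rewrite ?cosN //; lra.
Qed.

Lemma polar_inj (r r' th th' : R) : 0 < r -> 0 < r' -> `|th - th'| < 2 * pi ->
  polar r th = polar r' th' -> r = r' /\ th = th'.
Proof.
move=> r0 r'0 d [ec es].
have sqE (a x : R) : (a * cos x) ^+ 2 + (a * sin x) ^+ 2 = a ^+ 2.
  by rewrite !exprMn -mulrDr cos2Dsin2 mulr1.
have sq : r ^+ 2 = r' ^+ 2 by rewrite -(sqE r th) -(sqE r' th') ec es.
have rr : r = r' by apply/eqP; rewrite -(eqrXn2 (n := 2) isT (ltW r0) (ltW r'0)) sq.
split=> //; apply/eqP; rewrite -subr_eq0; apply/eqP; apply: cos_eq1 => //.
have nz : r != 0 by rewrite gt_eqF.
move: ec es; rewrite -rr => /(mulfI nz) ec /(mulfI nz) es.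
by rewrite cosB ec es -!expr2 cos2Dsin2.
Qed.

End Polar.

Section DrawingOrder.
Local Open Scope classical_set_scope.
Variables (R : realType) (G : digraph).

(** [plane_drawing] treats end points and interiors of arcs separately; here they are assembled for
    closed arcs without a common end. *)
Lemma plane_drawing_meet (pt : G -> R * R) gamma (u v u' v' : G) (s t : R) :
  plane_drawing pt gamma -> edge u v -> edge u' v' ->
  u <> u' -> u <> v' -> v <> u' -> v <> v' -> 0 <= s <= 1 -> 0 <= t <= 1 ->
  gamma u v s <> gamma u' v' t.
Proof.
move=> D uv u'v' uu uv' vu vv s01 t01 e.
have [e0 e1] := drawing_ends D uv; have [e0' e1'] := drawing_ends D u'v'.
have ends (x : R) : 0 <= x <= 1 -> [\/ x = 0, x = 1 | 0 < x < 1].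
  rewrite !le_eqVlt => /andP[/orP[/eqP<-|x0] /orP[/eqP x1|x1]].
  - by constructor 1.
  - by constructor 1.
  - by constructor 2.
  - by constructor 3; rewrite x0.
have inj := drawing_pt_inj D.
case: (ends s s01) => hs; case: (ends t t01) => ht; move: e; rewrite ?hs ?ht ?e0 ?e1 ?e0' ?e1'.
- by move/inj.
- by move/inj.
- by move=> e; apply: (drawing_avoids D (w := u) u'v' ht); rewrite e.
- by move/inj.
- by move/inj.
- by move=> e; apply: (drawing_avoids D (w := v) u'v' ht); rewrite e.
- exact: (drawing_avoids D uv hs).
- exact: (drawing_avoids D uv hs).
- by apply: (drawing_noncrossing D uv u'v') => //; case.
Qed.

(** The colour is the part and the position is the radius. Two edges with reversed heads would meet
    by [sector_crossing], although they have no common end. *)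
Lemma three_annular_order : three_annular R G ->
  exists (col : G -> 'Z_3) (pos : G -> R), annular_order col pos.
Proof.
move=> [A [[part ring] [pt [gamma [D hl sec]]]]].
have /choice[cp hcp] : forall v : G, exists p : 'Z_3 * R,
    [/\ v \in A p.1, 0 < p.2 & pt v = polar p.2 (angle R p.1)].
  move=> v; have [i [vi _]] := part v; have [r r0 e] := hl i v vi.
  by exists (i, r).
pose col v := (cp v).1; pose pos v := (cp v).2; exists col, pos.
have colA v i : v \in A i -> col v = i.
  by move=> vi; have [j [_ u]] := part v; have [vj _ _] := hcp v;
    rewrite -(u _ vi) /col -(u _ vj).
have ce u v : edge u v -> col v = col u + 1.
  by move=> /ring[i [/colA-> /colA->]].
split=> //.
- by move=> v; have [_ ? _] := hcp v.
- move=> u v cuv puv; apply: (drawing_pt_inj D).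
  have [_ _ ->] := hcp u; have [_ _ ->] := hcp v.
  by rewrite -/(col u) -/(pos u) cuv puv.
move=> u v u' v' uv u'v' cuu' pu; rewrite leNgt; apply/negP => pv.
have cv := ce _ _ uv; have cv' := ce _ _ u'v'.
have arc x y : edge x y -> col x = col u ->
    gamma x y 0 = polar (pos x) (angle R (col u)) /\
    gamma x y 1 = polar (pos y) (angle R (col u).+1).
  move=> xy cx; have [-> ->] := drawing_ends D xy.
  have [_ _ ->] := hcp x; have [_ _ ->] := hcp y.
  rewrite -/(col x) -/(col y) -/(pos x) -/(pos y) (ce _ _ xy) cx; split=> //.
  by have := congr1 (fun f => f (pos y)) (angle_next R (col u)).
have inA x : x \in A (col x) by have [] := hcp x.
have sect x y : edge x y -> col x = col u -> forall t : R, 0 <= t <= 1 ->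
    sector (angle R (col u)) (angle R (col u).+1) (gamma x y t).
  by move=> xy cx; apply: sec => //; [rewrite -cx|rewrite -cx -(ce _ _ xy)].
have [f0 f1] := arc u v uv erefl; have [g0 g1] := arc u' v' u'v' (esym cuu').
have hd : 0 < angle R (col u).+1 - angle R (col u) < pi.
  by rewrite angleS addrC addKr angle1_itv.
have ps x : 0 < pos x by have [] := hcp x.
have [||s [t [s01 t01]]] := sector_crossing hd (drawing_continuous D uv) (drawing_continuous D u'v')
  (sect _ _ uv erefl) (sect _ _ u'v' (esym cuu')) f0 f1 g0 g1.
- by rewrite ps.
- by rewrite ps.
(* A tail and a head have different colours, and the two tails, like the two heads, have different
   positions. *)
have c1 (i : 'Z_3) : i <> i + 1 by case: i => [[|[|[|//]]] hi].
apply: (plane_drawing_meet D uv u'v') => // e.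
- by move: pu; rewrite e ltxx.
- by apply: (c1 (col u)); rewrite {2}cuu' -cv' e.
- by apply: (c1 (col u)); rewrite {1}cuu' -cv e.
- by move: pv; rewrite e ltxx.
Qed.

Definition arc (col : G -> 'Z_3) (pos : G -> R) (u v : G) (t : R) : R * R :=
  polar ((1 - t) * pos u + t * pos v) (angle R (col u) + t * angle R 1).

Lemma order_three_annular (col : G -> 'Z_3) (pos : G -> R) :
  annular_order col pos -> three_annular R G.
Proof.
move=> O; pose pt v := polar (pos v) (angle R (col v)).
have pos0 := ao_pos O.
have rad0 u v (t : R) : 0 <= t <= 1 -> 0 < (1 - t) * pos u + t * pos v.
  move=> /andP[t0 t1]; have u0 := pos0 u; have v0 := pos0 v.
  move: t0; rewrite le_eqVlt => /orP[/eqP<-|t0]; first by rewrite subr0 mul1r mul0r addr0.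
  by rewrite ltr_wpDl ?mulr_gt0 // mulr_ge0 ?subr_ge0 // ltW.
have angleE k : angle R k = k%:R * angle R 1 by rewrite /angle; lra.
have d0 : 0 < angle R 1 by case/andP: (angle1_itv R).
have d3 : 3 * angle R 1 = 2 * pi by rewrite /angle; lra.
have col2 v : (col v)%:R <= 2 :> R by rewrite (ler_nat R _ 2) -ltnS ltn_ord.
have col0 v : 0 <= (col v)%:R :> R by [].
(* Angles are measured in thirds of a turn, so the bound 3 says that they differ by less than a full
   turn. *)
have same u v (s t r r' : R) : 0 <= s <= 1 -> 0 <= t <= 1 -> 0 < r -> 0 < r' ->
    `|((col u)%:R + s) - ((col v)%:R + t)| < 3 ->
    polar r (angle R (col u) + s * angle R 1) = polar r' (angle R (col v) + t * angle R 1) ->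
    r = r' /\ (col u)%:R + s = (col v)%:R + t.
  move=> s01 t01 r0 r'0 lt3; rewrite 2!(angleE (nat_of_ord _)) -!mulrDl.
  move=> e; have [|-> /(mulIf (lt0r_neq0 d0))] // := polar_inj r0 r'0 _ e.
  by rewrite -mulrBl normrM (gtr0_norm d0) -d3 ltr_pM2r.
have ptE v : pt v = polar (pos v) (angle R (col v) + 0 * angle R 1).
  by rewrite mul0r addr0.
exists (fun i => [set v | col v == i]%SET); split.
  split=> [v|u v uv].
    by exists (col v); split=> [|j]; rewrite inE // => /eqP.
  by exists (col u); rewrite !inE eqxx (ao_edge O uv).
exists pt, (arc col pos); split; first split.
- move=> u v; rewrite !ptE => /same[]; rewrite ?lexx ?ler01 //.
    rewrite !addr0 ltr_norml.
    by have := col0 u; have := col2 u; have := col0 v; have := col2 v; lra.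
  rewrite !addr0 => pe /eqP; rewrite eqr_nat => /eqP /val_inj ce.
  exact: (ao_inj O).
- move=> u v uv; apply: continuous_subspaceT => t.
  have cang : (fun x : R => angle R (col u) + x * angle R 1) x @[x --> t] -->
      angle R (col u) + t * angle R 1.
    by apply: cvgD; [exact: cvg_cst|apply: cvgM; [exact: cvg_id|exact: cvg_cst]].
  have crad : (fun x : R => (1 - x) * pos u + x * pos v) x @[x --> t] -->
      (1 - t) * pos u + t * pos v.
    apply: cvgD; apply: cvgM; try exact: cvg_cst; last exact: cvg_id.
    by apply: cvgB; [exact: cvg_cst|exact: cvg_id].
  apply: (@cvg_pair _ _ _ (nbhs t) (nbhs _) (nbhs _)); apply: cvgM => //.
    by apply: (cvg_comp _ _ cang); exact: continuous_cos.
  by apply: (cvg_comp _ _ cang); exact: continuous_sin.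
- move=> u v uv s t s01 t01 /same[] // ; try exact: rad0.
    by rewrite ltr_norml; move: s01 t01 => /andP[? ?] /andP[? ?]; lra.
  by move=> _ /addrI.
- move=> u v uv; rewrite /arc /pt subr0 subrr !mul1r !mul0r add0r !addr0; split=> //.
  rewrite -angleS (ao_edge O uv).
  by have := congr1 (fun f => f (pos v)) (angle_next R (col u)).
- move=> u v w uv t /andP[t0 t1]; rewrite ptE => /same[]; rewrite ?lexx ?ler01 //.
  + by rewrite !ltW.
  + by apply: rad0; rewrite !ltW.
  + rewrite ltr_norml.
    by have := col0 u; have := col2 u; have := col0 w; have := col2 w; lra.
  move=> _; rewrite addr0 => e.
  (* The angle of an inner point lies strictly between two consecutive integers, that of a vertex is
     an integer. *)
  have : (col u)%:R < (col w)%:R :> R by lra.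
  have : (col w)%:R < (col u).+1%:R :> R by rewrite -natr1; lra.
  by rewrite !ltr_nat ltnS => h1 h2; have := leq_trans h2 h1; rewrite ltnn.
- move=> u v u' v' uv u'v' ne s t /andP[s0 s1] /andP[t0 t1] /same[].
  + by rewrite !ltW.
  + by rewrite !ltW.
  + by apply: rad0; rewrite !ltW.
  + by apply: rad0; rewrite !ltW.
  + rewrite ltr_norml.
    by have := col0 u; have := col2 u; have := col0 u'; have := col2 u'; lra.
  move=> re e.
  have : (col u)%:R < (col u').+1%:R :> R by rewrite -natr1; lra.
  have : (col u')%:R < (col u).+1%:R :> R by rewrite -natr1; lra.
  rewrite !ltr_nat !ltnS => h1 h2.
  have ce : col u = col u' by apply/val_inj/eqP; rewrite eqn_leq h1 h2.
  have st : s = t by move: e; rewrite ce => /addrI.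
  have cve : col v = col v' by rewrite (ao_edge O uv) (ao_edge O u'v') ce.
  (* Both points have the same parameter, strictly between 0 and 1. If the tails differ in position,
     [ao_mono] makes the radii strictly ordered; if not, equal radii force equal heads. *)
  case: (ltrgtP (pos u) (pos u')) => pu.
  - have pv := ao_mono O uv u'v' ce pu; move: re; rewrite st; apply/eqP.
    rewrite lt_eqF // ltr_leD //; first by rewrite ltr_pM2l // subr_gt0.
    by rewrite ler_pM2l.
  - have pv := ao_mono O u'v' uv (esym ce) pu; move: re; rewrite st; apply/eqP.
    rewrite gt_eqF // ltr_leD //; first by rewrite ltr_pM2l // subr_gt0.
    by rewrite ler_pM2l.
  - move: re; rewrite pu st => /addrI /(mulfI (lt0r_neq0 t0)) pv.
    by apply: ne; rewrite (ao_inj O ce pu) (ao_inj O cve pv).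
- by move=> i v; rewrite inE => /eqP<-; exists (pos v).
- move=> i u v; rewrite !inE => /eqP cu /eqP cv uv t t01.
  exists (angle R (col u) + t * angle R 1).
    rewrite -cu (angleS R (col u)); case/andP: t01 => t0 t1.
    apply/andP; split; first by rewrite lerDl (mulr_ge0 t0 (ltW d0)).
    by rewrite lerD2l ler_piMl // ltW.
  by exists ((1 - t) * pos u + t * pos v) => //; exact: rad0.
Qed.

End DrawingOrder.

(** * Obstructions to an order *)

Section Obstructions.
Variable R : realDomainType.

Lemma annular_order_contains (G H : digraph) (col : G -> 'Z_3) (pos : G -> R) :
  annular_order col pos -> contains G H ->
  exists (col' : H -> 'Z_3) (pos' : H -> R), annular_order col' pos'.
Proof.
move=> O [f [finj fe]]; exists (col \o f), (pos \o f); split=> /=.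
- by move=> v; exact: ao_pos O _.
- by move=> u v /fe /(ao_edge O).
- by move=> u v cuv puv; apply/finj/(ao_inj O).
- by move=> u v u' v' /fe uv /fe u'v'; exact: (ao_mono O).
Qed.

(** Negating the colours restores the step [+ 1], and monotonicity along reversed edges is the
    contrapositive of [ao_mono]. *)
Lemma annular_order_reverse (G : digraph) (col : G -> 'Z_3) (pos : G -> R) :
  annular_order col pos -> @annular_order R (reverse G) (fun v => - col v) pos.
Proof.
move=> O; split=> /=.
- exact: ao_pos O.
- by move=> u v /(ao_edge O) ->; rewrite opprD subrK.
- by move=> u v /oppr_inj; exact: ao_inj O _ _.
- move=> u v u' v' uv u'v' /oppr_inj cuu' puu'; rewrite leNgt; apply/negP => pvv'.
  have cvv' : col v' = col v.
    by apply: (addIr 1); rewrite -(ao_edge O uv) -(ao_edge O u'v').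
  by have := ao_mono O u'v' uv cvv' pvv'; rewrite leNgt puu'.
Qed.

Lemma next_next_neq (T : eqType) (c : seq T) (x : T) :
  uniq c -> (2 < size c)%N -> x \in c -> next c (next c x) != x.
Proof.
move=> uc sc xc; have [i c' rc] := rot_to xc.
rewrite -!(next_rot i uc) rc.
move: uc sc; rewrite -(rot_uniq i) -(size_rot i) rc.
case: c' {rc} => [|y [|z c']] //= /andP[]; rewrite !inE !negb_or.
case/and3P=> xy xz _ _ _; rewrite eqxx.
by rewrite (eq_sym y) (negPf xy) eqxx eq_sym.
Qed.

(** Let [x] be the outermost of the rim vertices coloured as heads of the hub's out-edges ([out]).
    It has edges to both of its rim neighbours, and each of these is also the head of an edge from
    an [out] vertex of smaller position. So each neighbour is at most the other in position, hence
    they coincide, but the rim is longer than two. *)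
Lemma diwheel_no_order (H : digraph) (col : H -> 'Z_3) (pos : H -> R) :
  is_diwheel H -> ~ annular_order col pos.
Proof.
move=> [h [c [/andP[sc _] [/andP[hc uc] _] _ _ tri]]] O.
have sc2 : (2 < size c)%N by exact: leq_trans sc.
have Z3 (i : 'Z_3) : (i == i + 1) = false /\ (i + 1 == i + 1 + 1 + 1) = false.
  by case: i => [[|[|[|//]]] hi].
have triP x : x \in c -> edge x (next c x) /\ edge (next c x) h /\ edge h x \/
                         edge x h /\ edge h (next c x) /\ edge (next c x) x.
  by move=> /tri /orP[] /andP[/= /and4P[? ? ? _] _]; [left|right].
pose out x := (x \in c) && (col x == col h + 1).
have nout x : out x -> edge x (next c x).
  case/andP=> xc /eqP cx; case: (triP x xc) => [[] //|[/(ao_edge O) e _]].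
  by have [_ /eqP[]] := Z3 (col h); rewrite -cx -e.
have pout x : out x -> edge x (prev c x).
  case/andP=> xc /eqP cx; have pc : prev c x \in c by rewrite mem_prev.
  have [] := triP _ pc; rewrite next_prev //; last by case=> _ [_ ?].
  move=> [_ [/(ao_edge O) e _]].
  by have [_ /eqP[]] := Z3 (col h); rewrite -cx -e.
have nnout x : out x -> out (next c (next c x)).
  move=> ox; have xe := ao_edge O (nout x ox); case/andP: (ox) => xc /eqP cx.
  have nc : next c x \in c by rewrite mem_next.
  rewrite /out mem_next nc /=; apply/eqP.
  have [] := triP _ nc.
    by move=> [_ [_ /(ao_edge O)]]; rewrite xe => /addIr; rewrite cx => /esym/eqP; rewrite (Z3 _).1.
  by move=> [_ [/(ao_edge O)]].
have ppout x : out x -> out (prev c (prev c x)).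
  move=> ox; have xe := ao_edge O (pout x ox); case/andP: (ox) => xc /eqP cx.
  have nc : prev c (prev c x) \in c by rewrite !mem_prev.
  rewrite /out nc /=; apply/eqP.
  have [] := triP _ nc; rewrite next_prev //.
    by move=> [_ [_ /(ao_edge O)]].
  by move=> [_ [/(ao_edge O)]]; rewrite xe => /addIr; rewrite cx => /esym/eqP; rewrite (Z3 _).1.
have [x0 ox0] : exists x, out x.
  have [a ac] : exists a, a \in c.
    by case: (c) sc => // a c' _; exists a; rewrite inE eqxx.
  have [[_ [_ /(ao_edge O) e]]|[_ [/(ao_edge O) e _]]] := triP a ac.
    by exists a; rewrite /out ac e eqxx.
  by exists (next c a); rewrite /out mem_next ac e eqxx.
have [x ox xmax] := arg_maxP pos ox0.
have xc : x \in c by case/andP: ox.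
have lt z : out z -> z != x -> pos z < pos x /\ col z = col x.
  move=> oz zx; case/andP: (oz) => _ /eqP cz; case/andP: (ox) => _ /eqP cx.
  split; last by rewrite cz cx.
  rewrite lt_neqAle (xmax _ oz : pos z <= pos x) andbT; apply: contra zx => /eqP e.
  by apply/eqP/(ao_inj O); rewrite // cz cx.
have nn := next_next_neq uc sc2 xc.
have pp : prev c (prev c x) != x.
  apply: contra nn => /eqP e; apply/eqP.
  by rewrite -{1}e !(next_prev uc).
have le1 : pos (next c x) <= pos (prev c x).
  have [z1 z2] := lt _ (nnout x ox) nn.
  apply: (ao_mono O _ (pout x ox) z2 z1).
  by have := pout _ (nnout x ox); rewrite prev_next.
have le2 : pos (prev c x) <= pos (next c x).
  have [z1 z2] := lt _ (ppout x ox) pp.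
  apply: (ao_mono O _ (nout x ox) z2 z1).
  by have := nout _ (ppout x ox); rewrite next_prev.
have e : next c x = prev c x.
  apply: (ao_inj O); last by apply/le_anti; rewrite le1 le2.
  by rewrite (ao_edge O (nout x ox)) (ao_edge O (pout x ox)).
by move: nn; rewrite e next_prev // eqxx.
Qed.

(** With [a] between [a1] and [a3], monotonicity squeezes [b] between [x] and [x]. *)
Lemma no_middle_leg (H : digraph) (col : H -> 'Z_3) (pos : H -> R)
    (x a1 a a3 b : H) : annular_order col pos ->
  edge a1 x -> edge a x -> edge a3 x -> edge a b -> b != x ->
  ~~ (pos a1 < pos a < pos a3).
Proof.
move=> O a1x ax a3x ab bx; apply/negP => /andP[lt1 lt3].
have c1 : col a1 = col a.
  by apply: (addIr 1); rewrite -(ao_edge O a1x) -(ao_edge O ax).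
have c3 : col a = col a3.
  by apply: (addIr 1); rewrite -(ao_edge O a3x) -(ao_edge O ax).
move/eqP: bx; apply; apply: (ao_inj O).
  by rewrite (ao_edge O ab) (ao_edge O ax).
apply: le_anti.
by rewrite (ao_mono O ab a3x c3 lt3) (ao_mono O a1x ab c1 lt1).
Qed.

Lemma middle_of_three (p1 p2 p3 : R) : p1 != p2 -> p1 != p3 -> p2 != p3 ->
  [|| p1 < p2 < p3, p3 < p2 < p1, p2 < p1 < p3, p3 < p1 < p2,
      p1 < p3 < p2 | p2 < p3 < p1].
Proof.
case: (ltgtP p1 p2) => // h12 _; case: (ltgtP p1 p3) => // h13 _;
  case: (ltgtP p2 p3) => // h23 _; exfalso; lra.
Qed.

Definition v8 (k : nat) (hk : (k < 8)%N) : 'I_8 := Ordinal hk.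

(** Whichever of the three [a] vertices is in the middle, its leg contradicts [no_middle_leg]. *)
Lemma brancher1_no_order (col : brancher1 -> 'Z_3) (pos : brancher1 -> R) :
  ~ annular_order col pos.
Proof.
move=> O.
pose x : brancher1 := @v8 0 isT.
pose a1 : brancher1 := @v8 2 isT; pose a2 : brancher1 := @v8 3 isT; pose a3 : brancher1 := @v8 4 isT.
pose b1 : brancher1 := @v8 5 isT; pose b2 : brancher1 := @v8 6 isT; pose b3 : brancher1 := @v8 7 isT.
have e1 : edge a1 x by []. have e2 : edge a2 x by []. have e3 : edge a3 x by [].
have f1 : edge a1 b1 by []. have f2 : edge a2 b2 by []. have f3 : edge a3 b3 by [].
have ne u v : u != v -> edge u x -> edge v x -> pos u != pos v.
  move=> uv ux vx; apply: contra uv => /eqP puv; apply/eqP/(ao_inj O) => //.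
  by apply: (addIr 1); rewrite -(ao_edge O ux) -(ao_edge O vx).
have := middle_of_three (ne a1 a2 isT e1 e2) (ne a1 a3 isT e1 e3) (ne a2 a3 isT e2 e3).
apply/negP; rewrite !negb_or.
by rewrite !(no_middle_leg O (x := x) (a := a1) (b := b1)) // !(no_middle_leg O (x := x) (a := a2) (b := b2)) //
  !(no_middle_leg O (x := x) (a := a3) (b := b3)).
Qed.

(** By [no_middle_leg] only [a3] can be in the middle. Then [x] lies strictly between [b1] and [b2],
    both of which have edges to [y], and the edge from [x] to [b3] squeezes [b3] onto [y]; this is
    [key]. *)
Lemma brancher2_no_order (col : brancher2 -> 'Z_3) (pos : brancher2 -> R) :
  ~ annular_order col pos.
Proof.
move=> O.
pose x : brancher2 := @v8 0 isT; pose y : brancher2 := @v8 1 isT.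
pose a1 : brancher2 := @v8 2 isT; pose a2 : brancher2 := @v8 3 isT; pose a3 : brancher2 := @v8 4 isT.
pose b1 : brancher2 := @v8 5 isT; pose b2 : brancher2 := @v8 6 isT; pose b3 : brancher2 := @v8 7 isT.
have e1 : edge a1 x by []. have e2 : edge a2 x by []. have e3 : edge a3 x by [].
have f1 : edge a1 b1 by []. have f2 : edge a2 b2 by [].
have par u v w : edge u w -> edge v w -> col u = col v.
  by move=> uw vw; apply: (addIr 1); rewrite -(ao_edge O uw) -(ao_edge O vw).
have chi u v w : edge w u -> edge w v -> col u = col v.
  by move=> uw vw; rewrite (ao_edge O uw) (ao_edge O vw).
have nep u v : u != v -> col u = col v -> pos u != pos v.
  by move=> uv cuv; apply: contra uv => /eqP puv; apply/eqP/(ao_inj O).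
have ne u v : u != v -> edge u x -> edge v x -> pos u != pos v.
  by move=> uv ux vx; apply: nep uv (par _ _ _ ux vx).
have key (p q r s : brancher2) : edge p x -> edge q x -> edge p r -> edge q s ->
    r != x -> s != x -> edge r y -> edge s y -> ~~ (pos p < pos a3 < pos q).
  move=> px qx pr qs rx sx ry sy; apply/negP => /andP[lt1 lt2].
  have xy : edge x y by []. have xb : edge x b3 by [].
  have l1 : pos r < pos x.
    rewrite lt_neqAle (nep _ _ rx (chi _ _ _ pr px)).
    exact: (ao_mono O pr e3 (par _ _ _ px e3) lt1).
  have l2 : pos x < pos s.
    rewrite lt_neqAle (nep x s _ (chi _ _ _ qx qs)) 1?eq_sym //.
    exact: (ao_mono O e3 qs (par _ _ _ e3 qx) lt2).
  have m1 := ao_mono O ry xb (par _ _ _ ry xy) l1.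
  have m2 := ao_mono O xb sy (par _ _ _ xy sy) l2.
  have := nep y b3 isT (chi _ _ _ xy xb).
  by rewrite eq_le m1 m2.
have := middle_of_three (ne a1 a2 isT e1 e2) (ne a1 a3 isT e1 e3) (ne a2 a3 isT e2 e3).
apply/negP; rewrite !negb_or.
rewrite !(no_middle_leg O (x := x) (a := a1) (b := b1)) // !(no_middle_leg O (x := x) (a := a2) (b := b2)) //=.
by rewrite (key a1 a2 b1 b2) // (key a2 a1 b2 b1).
Qed.

Lemma brancher_no_order (G B : digraph) (col : G -> 'Z_3) (pos : G -> R) :
  annular_order col pos -> is_brancher B -> ~ contains G B.
Proof.
have direct (H : digraph) (c : H -> 'Z_3) (p : H -> R) : annular_order c p ->
    ~ contains H brancher1 /\ ~ contains H brancher2.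
  by move=> O; split=> /(annular_order_contains O)[c' [p']];
    [exact: brancher1_no_order|exact: brancher2_no_order].
move=> O; have [n1 n2] := direct _ _ _ O.
have [r1 r2] := direct _ _ _ (annular_order_reverse O).
case=> -> // -[f [finj fe]]; [apply: r1|apply: r2]; exists f; split=> // u v uv;
  exact: (fe v u).
Qed.

End Obstructions.

(** * Directed cycles and tricycles *)

Section Z3.
Implicit Types i k : 'Z_3.

Lemma Z3_cases i k : [\/ k = i, k = i + 1 | k = i + 1 + 1].
Proof.
suff /or3P[/eqP|/eqP|/eqP] : [|| k == i, k == i + 1 | k == i + 1 + 1].
- by constructor 1.
- by constructor 2.
- by constructor 3.
by case: i k => [[|[|[|//]]] ?] [[|[|[|//]]] ?].
Qed.

Lemma Z3_add3 i : i + 1 + 1 + 1 = i.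
Proof. by apply/eqP; case: i => [[|[|[|//]]] ?]. Qed.

Lemma Z3_neq1 i : (i + 1 == i) = false.
Proof. by case: i => [[|[|[|//]]] ?]. Qed.

Lemma Z3_neq2 i : (i + 1 + 1 == i) = false.
Proof. by case: i => [[|[|[|//]]] ?]. Qed.

Lemma Z3_neq12 i : (i + 1 + 1 == i + 1) = false.
Proof. exact: Z3_neq1. Qed.

End Z3.

Lemma not_uniq_split (T : eqType) (p : seq T) : ~~ uniq p ->
  exists y p1 p2 p3, p = p1 ++ y :: p2 ++ y :: p3.
Proof.
elim: p => // a p IH /=; rewrite negb_and negbK => /orP[|/IH].
  by case/splitPr=> p1 p2; exists a, [::], p1, p2.
by case=> y [p1 [p2 [p3 ->]]]; exists y, (a :: p1), p2, p3.
Qed.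

Section Coloring.
Variable G : digraph.
Hypothesis hcyc : three_cyclic G.

(** Induction on the length: a repeated vertex splits the walk into two shorter closed walks, and
    without repetition it is a directed cycle. *)
Lemma closed_walk_mod3 (x : G) (p : seq G) :
  path edge x p -> last x p = x -> (3 %| size p)%N.
Proof.
move: {2}(size p) (leqnn (size p)) => n.
elim: n x p => [|n IH] x p; first by case: p.
case up: (uniq p).
  case/lastP: p up => // p z; rewrite last_rcons size_rcons => up _ px zx.
  move: zx px up => ->; rewrite rcons_uniq => px up.
  by rewrite (_ : (size p).+1 = 3)%N //; apply: (hcyc (c := x :: p)) => //; apply/andP.
have [y [p1 [p2 [p3 ->]]]] := not_uniq_split (negbT up).
rewrite cat_path /= cat_path /= last_cat /= last_cat /= !size_cat /= size_cat /= => sz.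
case/and4P=> h1 h2 h3 /andP[h4 h5] hl.
have d1 : (3 %| size (p1 ++ y :: p3))%N.
  apply: (IH x); first by rewrite size_cat /=; lia.
    by rewrite cat_path /= h1 h2.
  by rewrite last_cat.
have d2 : (3 %| size (rcons p2 y))%N.
  apply: (IH y); first by rewrite size_rcons; lia.
    by rewrite rcons_path h3.
  by rewrite last_rcons.
move: d1 d2; rewrite size_cat size_rcons /=; lia.
Qed.

(** The colour is the length modulo 3 of a chosen walk from a root. The chosen walk to [v] and the
    one through [uv] are compared by closing both with the same walk back to the root. *)
Lemma three_coloring : strongly_connected G ->
  exists col : G -> 'Z_3, forall u v : G, edge u v -> col v = col u + 1.
Proof.
case=> /card_gt0P[v0 _] con.
have walk (u v : G) : exists p, path edge u p && (last u p == v).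
  by have /connectP[p pp ->] := con u v; exists p; rewrite pp eqxx.
pose P v := xchoose (walk v0 v).
exists (fun v => (size (P v))%:R) => u v uv.
have /andP[pu /eqP lu] := xchooseP (walk v0 u).
have /andP[pv /eqP lv] := xchooseP (walk v0 v).
have [q /andP[pq /eqP lq]] := walk v v0.
have Z3_dvd m : (3 %| m)%N -> m%:R = 0 :> 'Z_3.
  by case/dvdnP=> k ->; rewrite natrM (_ : 3%:R = 0) ?mulr0 //; apply/eqP.
have d1 : (3 %| size (P v ++ q))%N.
  by apply: (@closed_walk_mod3 v0); rewrite ?cat_path ?last_cat lv ?pv.
have d2 : (3 %| size (P u ++ v :: q))%N.
  by apply: (@closed_walk_mod3 v0); rewrite ?cat_path ?last_cat /= ?lu ?uv ?pu.
have := etrans (Z3_dvd _ d1) (esym (Z3_dvd _ d2)).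
by rewrite !size_cat -(addSnnS (size (P u))) !natrD => /addIr ->; rewrite natr1.
Qed.

Lemma return_path (u v : G) (p : seq G) : edge u v -> path edge v p ->
  last v p = u -> uniq (v :: p) -> size p = 2.
Proof.
move=> uv pp lp up; have /= : size (v :: p) = 3.
  by apply: hcyc => //; rewrite /ucycle /= rcons_path pp lp uv.
by case.
Qed.

(** A simple path of [S] from [v] to [u] closes up with [uv] to a directed cycle, so it has two
    edges. *)
Lemma return_edges (u v : G) (S : rel G) : edge u v -> subrel S edge ->
  connect S v u -> exists2 w, S v w & S w u.
Proof.
move=> uv Se /connectP[p pp lp].
case/shortenP: pp lp => p' pp' up' _ lp.
have := return_path uv (sub_path Se pp') (esym lp) up'.
case: p' pp' up' lp => [|w [|z []]] //= /and3P[vw wz _] _ -> _.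
by exists w.
Qed.

Lemma no_hexagon (a b c d e f : G) :
  edge a b -> edge b c -> edge c d -> edge d e -> edge e f -> edge f a ->
  ~~ uniq [:: a; b; c; d; e; f].
Proof.
move=> ab bc cd de ef fa; apply/negP => u.
have //: size [:: a; b; c; d; e; f] = 3.
by apply: hcyc => //; rewrite /ucycle u /= ab bc cd de ef fa.
Qed.

End Coloring.

Section Tricycles.
Variable G : digraph.
Hypothesis hcyc : three_cyclic G.
Variable col : G -> 'Z_3.
Hypothesis hcol : forall u v : G, edge u v -> col v = col u + 1.
Local Notation triple := {ffun 'Z_3 -> G}.

(** Requiring the vertex at index [i] to have colour [i] leaves one of the three rotations of each
    directed triangle. *)
Definition tricycle (t : triple) : bool :=
  [forall i, (col (t i) == i) && edge (t i) (t (i + 1))].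

Definition triple_at (i : 'Z_3) (a b c : G) : triple :=
  [ffun k => if k == i then a else if k == i + 1 then b else c].

Lemma triple_atE i a b c :
  [/\ triple_at i a b c i = a, triple_at i a b c (i + 1) = b &
      triple_at i a b c (i + 1 + 1) = c].
Proof. by rewrite !ffunE !eqxx Z3_neq1 Z3_neq2 Z3_neq12. Qed.

Lemma tricycle_edge t i : tricycle t -> edge (t i) (t (i + 1)).
Proof. by move/forallP/(_ i)/andP=> []. Qed.

Lemma tricycle_col t i : tricycle t -> col (t i) = i.
Proof. by move/forallP/(_ i)/andP=> [/eqP]. Qed.

Lemma tricycle_at (a b c : G) : edge a b -> edge b c -> edge c a ->
  tricycle (triple_at (col a) a b c).
Proof.
move=> ab bc ca; have [e0 e1 e2] := triple_atE (col a) a b c.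
apply/forallP => k; case: (Z3_cases (col a) k) => ->.
- by rewrite e0 e1 eqxx.
- by rewrite e1 e2 (hcol ab) eqxx.
- by rewrite Z3_add3 e2 e0 (hcol bc) (hcol ab) eqxx.
Qed.

Definition tri_closed (S : rel G) : Prop := forall t, tricycle t ->
  forall i, S (t i) (t (i + 1)) -> forall j, S (t j) (t (j + 1)).

Lemma tri_closedE (S : rel G) (a b c : G) : tri_closed S -> edge a b -> edge b c ->
  edge c a -> S a b -> S b c /\ S c a.
Proof.
move=> cl ab bc ca Sab; have [e0 e1 e2] := triple_atE (col a) a b c.
have H := cl _ (tricycle_at ab bc ca) (col a); rewrite e0 e1 in H.
have := H Sab (col a + 1); have := H Sab (col a + 1 + 1).
by rewrite Z3_add3 e0 e1 e2.
Qed.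

(** * Ears of a subdigraph closed under tricycles *)

Section ClosedSubgraph.
Variables (S : rel G) (W : {set G}).
Hypothesis Se : subrel S edge.
Hypothesis SW : forall u v, S u v -> (u \in W) && (v \in W).
Hypothesis Wcon : {in W &, forall u v, connect S u v}.
Hypothesis Scl : tri_closed S.

(* Closing an ear by a path of S makes a directed cycle, that is a tricycle,
   which shares an edge with S. *)
Lemma ear_is_edge (u v : G) (q : seq G) : u \in W -> v \in W -> u != v ->
  path edge u (rcons q v) -> uniq q -> {in q, forall w, w \notin W} ->
  q = [::] /\ S u v.
Proof.
move=> uW vW uv pq uq qW.
have /connectP[r0 r0p] := Wcon vW uW.
case/shortenP: r0p => r rp ur _ lr.
have rW : {in r, forall w, w \in W}.
  move=> w wr; clear -rp SW wr.
  elim: r v rp wr => //= a r IH v /andP[va ra]; rewrite inE => /orP[/eqP->|/(IH a ra)//].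
  by case/andP: (SW va).
case/lastP: r rp ur lr rW => [|r z]; first by move=> _ _ /= e; rewrite e eqxx in uv.
rewrite last_rcons => rp ur e; rewrite -{}e {z} in rp ur *; move=> rW.
have sz : size (u :: q ++ v :: r) = 3.
  apply: hcyc => //; apply/andP; split.
    rewrite /= -cat_rcons rcons_cat cat_path pq last_rcons /=.
    exact: sub_path rp.
  have uvr : uniq (u :: v :: r).
    by move: ur; rewrite -rcons_cons rcons_uniq.
  rewrite -cat_cons cat_uniq /=; move: uvr => /= /and3P[uvr -> ->].
  rewrite uq !andbT; apply/andP; split.
    by apply/negP => /qW; rewrite uW.
  rewrite !inE !negb_or in uvr *; case/andP: uvr => uv' ur'.
  rewrite eq_sym uv' /=; apply/andP; split; first by apply/negP => /qW; rewrite vW.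
  apply/hasPn => w wr; rewrite inE negb_or; apply/andP; split.
    by apply: contraNneq ur' => <-.
  by apply/negP => /qW; rewrite rW // mem_rcons inE wr orbT.
(* Either [q] is empty, and [uv] lies in a tricycle with two edges of [S]; or [r] is empty, and the
   single vertex of [q] lies in a tricycle with the edge [vu] of [S], which would put it into
   [W]. *)
have {}sz : (size q + size r = 1)%N by move: sz; rewrite /= size_cat /=; lia.
case: q r pq rp qW sz {ur uq rW} => [|w [|w' q]] [|w1 [|w2 r]] //= pq rp qW sz; try lia.
  case/and3P: rp => vw wu _; case/andP: pq => uv' _.
  by split=> //; have [] := tri_closedE Scl (Se vw) (Se wu) uv' vw.
case/andP: rp => vu _; case/and3P: pq => uw wv _.
have [/SW/andP[_ wW] _] := tri_closedE Scl (Se vu) uw wv vu.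
by have := qW w; rewrite inE eqxx wW => /(_ isT).
Qed.

Hypothesis hG : unbreakable G.
Variables (u0 v0 : G).
Hypotheses (u0W : u0 \in W) (v0W : v0 \in W) (uv0 : u0 != v0).

(** [eo] is the part of the digraph outside [W]; [enters] and [leaves] describe the two ends in [W]
    of a possible ear through [w]. *)
Let eo : rel G := fun x y => [&& edge x y, x \notin W & y \notin W].
Let enters p w := (p \in W) && [exists z, [&& edge p z, z \notin W & connect eo z w]].
Let leaves w p := (p \in W) && [exists z, [&& edge z p, z \notin W & connect eo w z]].

Lemma eo_out w z : w \notin W -> connect eo w z -> z \notin W.
Proof.
move=> wW /connectP[p + ->]; elim: p w wW => //= a p IH w wW /andP[/and3P[_ _ aW]].
exact: IH.
Qed.

(** Distinct ends would be joined by an ear with an inner vertex, which [ear_is_edge] excludes. *)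
Lemma enters_leaves p w q : enters p w -> leaves w q -> p = q.
Proof.
move=> /andP[pW /existsP[z /and3P[pz zW zw]]] /andP[qW /existsP[y /and3P[yq yW wy]]].
apply/eqP; apply: contraT => pq.
have /connectP[r0 r0p] := connect_trans zw wy.
case/shortenP: r0p => r rp ur _ ly.
have zrW : {in z :: r, forall w, w \notin W}.
  move=> x; rewrite inE => /orP[/eqP->//|xr].
  by apply: (eo_out zW); apply: (path_connect rp); rewrite inE xr orbT.
have [] // := ear_is_edge pW qW pq _ ur zrW.
rewrite /= pz rcons_path -ly yq andbT.
by apply: sub_path rp => a b /and3P[].
Qed.

Lemma outside_entered w : w \notin W -> exists p, enters p w.
Proof.
have /connectP[p pp lp] := (proj1 hG).2 u0 w; move=> wW.
suff : (last u0 p \in W) || [exists q, enters q (last u0 p)].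
  by rewrite -lp (negPf wW) /= => /existsP.
have : (u0 \in W) || [exists q, enters q u0] by rewrite u0W.
elim: p u0 pp {lp} => //= b p IH a /andP[ab bp] ha; apply: IH => //.
case: (boolP (b \in W)) => //= bW; case/orP: ha => [aW|/existsP[q /andP[qW /existsP[z /and3P[qz zW za]]]]].
  by apply/existsP; exists a; rewrite /enters aW; apply/existsP; exists b; rewrite ab bW connect0.
apply/existsP; exists q; rewrite /enters qW; apply/existsP; exists z; rewrite qz zW.
by apply: (connect_trans za (connect1 _)); rewrite /eo ab bW (eo_out zW za).
Qed.

Lemma outside_left w : w \notin W -> exists p, leaves w p.
Proof.
have /connectP[p pp lp] := (proj1 hG).2 w u0; move=> wW.
suff : (w \in W) || [exists q, leaves w q] by rewrite (negPf wW) => /existsP.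
elim: p w pp lp {wW} => [|b p IH] a /=; first by move=> _ <-; rewrite u0W.
move=> /andP[ab bp] /(IH _ bp) hb.
case: (boolP (a \in W)) => //= aW; case/orP: hb => [bW|/existsP[q /andP[qW /existsP[z /and3P[zq zW bz]]]]].
  by apply/existsP; exists b; rewrite /leaves bW; apply/existsP; exists a; rewrite ab aW connect0.
apply/existsP; case: (boolP (b \in W)) => bW.
  by exists b; rewrite /leaves bW; apply/existsP; exists a; rewrite ab aW connect0.
exists q; rewrite /leaves qW; apply/existsP; exists z; rewrite zq zW.
by apply: connect_trans (connect1 _) bz; rewrite /eo ab bW aW.
Qed.

(** By strong connectivity and [enters_leaves] an outside vertex is attached to [W] at a single
    vertex [p]. A walk of the underlying graph that avoids [p] keeps this attachment and never
    reaches [W], so [p] would be a cutvertex. *)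
Lemma closed_subgraph_spans w : w \in W.
Proof.
apply: contraT => wW; have [p pw] := outside_entered wW.
have [_ [_ ucon nocut]] := hG; case: (nocut p).
have pW : p \in W by case/andP: pw.
have [v vW vp] : exists2 v, v \in W & v != p.
  by case: (eqVneq u0 p) => [<-|]; [exists v0 => //; rewrite eq_sym|exists u0].
exists w, v; split=> //; first by apply: contraNneq wW => ->.
apply/negP => /connectP[r rp lr].
suff : enters p (last w r) by case/andP=> _ /existsP[z /and3P[_ zW /(eo_out zW)]]; rewrite -lr vW.
elim: r w pw rp {wW lr} => //= y r IH x px /andP[/and3P[xy xp yp] yr]; apply: IH => //.
have xW : x \notin W by case/andP: px => _ /existsP[z /and3P[_ zW /(eo_out zW)]].
have [q xq] := outside_left xW; have pq := enters_leaves px xq; rewrite -{q}pq in xq.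
(* For either direction of the edge, [y] in [W] would be an attachment of [x] and hence equal to
   [p]; outside [W], [y] inherits the attachment of [x]. *)
case/andP: xy => _ /orP[xy|yx]; case: (boolP (y \in W)) => yW.
- have /(enters_leaves px) e : leaves x y.
    by rewrite /leaves yW; apply/existsP; exists x; rewrite xy xW connect0.
  by rewrite e eqxx in yp.
- case/andP: px => _ /existsP[z /and3P[pz zW zx]].
  rewrite /enters pW; apply/existsP; exists z; rewrite pz zW.
  by apply: (connect_trans zx (connect1 _)); rewrite /eo xy xW.
- have /enters_leaves/(_ xq) e : enters y x.
    by rewrite /enters yW; apply/existsP; exists x; rewrite yx xW connect0.
  by rewrite e eqxx in yp.
- have [q yq] := outside_entered yW.
  suff <- : q = p by [].
  apply: enters_leaves xq; case/andP: yq => qW /existsP[z /and3P[qz zW zy]].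
  rewrite /enters qW; apply/existsP; exists z; rewrite qz zW.
  by apply: (connect_trans zy (connect1 _)); rewrite /eo yx xW yW.
Qed.

Lemma closed_subgraph_full (u v : G) : edge u v -> S u v.
Proof.
move=> uv; have [] // := @ear_is_edge u v [::];
  rewrite ?closed_subgraph_spans ?andbT //=; last by rewrite uv.
by apply: contraTneq uv => ->; rewrite edge_irr.
Qed.

End ClosedSubgraph.

End Tricycles.

(** * Strips of tricycles *)

Section Strips.
Variable G : digraph.
Variable col : G -> 'Z_3.
Local Notation triple := {ffun 'Z_3 -> G}.
Implicit Types (t x y : triple) (s p q : seq triple) (i j : 'Z_3).

Definition agree_off i t t' : bool := [forall j, (j != i) ==> (t j == t' j)].

Lemma agree_offP i t t' : reflect (forall j, j != i -> t j = t' j) (agree_off i t t').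
Proof.
apply: (iffP forallP) => h j; last by apply/implyP => /h->.
by move/(implyP (h j))/eqP.
Qed.

Lemma agree_offxx i t : agree_off i t t.
Proof. by apply/agree_offP. Qed.

Lemma agree_off_sym i t t' : agree_off i t t' = agree_off i t' t.
Proof. by apply: eq_forallb => j; rewrite (eq_sym (t j)). Qed.

Lemma agree_off_trans i t t' t'' :
  agree_off i t t' -> agree_off i t' t'' -> agree_off i t t''.
Proof. by move=> /agree_offP h1 /agree_offP h2; apply/agree_offP => j ji; rewrite h1 ?h2. Qed.

Lemma agree_off_unique i j t t' : agree_off i t t' -> t j != t' j -> j = i.
Proof. by move=> /agree_offP h; apply: contraNeq => /h->. Qed.

(* At each cut exactly one vertex is replaced, and no vertex returns, so that
   the tricycles of a strip at a given vertex are consecutive. *)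
Definition strip s : Prop := all (tricycle col) s /\
  forall p x y q, s = rcons p x ++ y :: q -> exists i, agree_off i x y /\
    {in rcons p x & y :: q, forall t t', t i != t' i}.

Lemma strip_rev s : strip s -> strip (rev s).
Proof.
move=> [st cut]; split=> [|p x y q e]; first by rewrite all_rev.
have [|i [xy sep]] := cut (rev q) y x (rev p).
  by rewrite -[s]revK e rev_cat rev_cons rev_rcons.
exists i; split; first by rewrite agree_off_sym.
move=> t t' tp tq; rewrite eq_sym; apply: sep.
  by rewrite -rev_cons mem_rev.
by rewrite -rev_rcons mem_rev.
Qed.

Lemma strip_cut p x y q : strip (rcons p x ++ y :: q) -> exists i, agree_off i x y /\
    {in rcons p x & y :: q, forall t t', t i != t' i}.
Proof. by move=> [_ cut]; exact: cut. Qed.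

(** The default of [head] makes the condition void for empty [s]. A later cut at an index other than
    [i] sees [x] as the head of [s]; at [i] the vertex of [x] is new. *)
Lemma strip_cons i x s : tricycle col x -> strip s -> agree_off i x (head x s) ->
  {in s, forall t, t i != x i} -> strip (x :: s).
Proof.
move=> tx [st cut] xs new; split=> [|p z y q]; first by rewrite /= tx.
case: p => [[<- e]|a p [<- e]] /=.
  exists i; split; first by rewrite e in xs.
  by move=> t t'; rewrite inE => /eqP-> t's; rewrite eq_sym new // e.
have [j [zy sep]] := cut p z y q e; exists j; split=> // t t'.
rewrite inE => /orP[/eqP->|tp t'q]; last exact: sep.
move=> t'q; have [->|ji] := eqVneq j i.
  by rewrite eq_sym new // e mem_cat t'q orbT.
rewrite (agree_offP _ _ _ xs j ji); apply: sep => //.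
by rewrite e; case: (p) => [|b p']; rewrite /= mem_head.
Qed.

Lemma strip_tail x s : strip (x :: s) -> strip s.
Proof.
move=> [/andP[_ st] cut]; split=> // p z y q e.
have [|i [zy sep]] := cut (x :: p) z y q; first by rewrite e.
by exists i; split=> // t t' tp; apply: sep; rewrite inE tp orbT.
Qed.

Lemma strip_head x s : strip (x :: s) -> tricycle col x /\
  exists i, agree_off i x (head x s) /\ {in s, forall t, t i != x i}.
Proof.
move=> [/andP[tx _] cut]; split=> //.
case: s cut => [|y s] cut; first by exists 0; split=> //; exact: agree_offxx.
have [|i [xy sep]] := cut [::] x y s; first by [].
by exists i; split=> // t ts; rewrite eq_sym; apply: sep; rewrite // inE.
Qed.

Lemma strip_uniq s : strip s -> uniq s.
Proof.
elim: s => //= x s IH xs; rewrite (IH (strip_tail xs)) andbT.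
have [_ [i [_ new]]] := strip_head xs.
by apply/negP => /new; rewrite eqxx.
Qed.

(** Cuts at other indices cannot tell [t] from [x], and at [i] the vertex of [t] is new. *)
Lemma strip_insert i p x y q t : strip (p ++ x :: y :: q) -> tricycle col t ->
  agree_off i x t -> agree_off i x y ->
  {in p ++ x :: y :: q, forall t', t' i != t i} -> strip (p ++ x :: t :: y :: q).
Proof.
move=> + tt xt xy; elim: p => [|a p IH] /= st new.
  have [tx [j [xy' newx]]] := strip_head st; have sty := strip_tail st.
  have ji : j = i by apply: agree_off_unique xy _; rewrite eq_sym newx ?mem_head.
  have sub z : z \in y :: q -> z \in x :: y :: q by move=> zq; rewrite inE zq orbT.
  apply: (strip_cons (i := i) tx) => //=.
    apply: (strip_cons (i := i) tt sty); last by move=> z /sub/new.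
    by rewrite /=; apply: agree_off_trans xy; rewrite agree_off_sym.
  move=> z; rewrite inE => /orP[/eqP->|zq]; last by rewrite -ji newx.
  by rewrite eq_sym new ?mem_head.
have [ta [j [aj newa]]] := strip_head st.
apply: (strip_cons (i := j) ta).
- by apply: IH (strip_tail st) _ => z zs; apply: new; rewrite inE zs orbT.
- by case: (p) aj.
move=> z; rewrite mem_cat !inE.
have [->|zt] := eqVneq z t.
  move=> _; have [->|ji] := eqVneq j i; first by rewrite eq_sym new ?mem_head.
  rewrite -(agree_offP _ _ _ xt j ji); apply: newa.
  by rewrite mem_cat mem_head orbT.
by move=> /= zs; apply: newa; rewrite mem_cat !inE.
Qed.

Lemma strip_remove i p x t y q : strip (p ++ x :: t :: y :: q) ->
  agree_off i x t -> agree_off i t y -> strip (p ++ x :: y :: q).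
Proof.
move=> + xt ty; elim: p => [|a p IH] /= st.
  have [tx [j [_ newx]]] := strip_head st; have sty := strip_tail (strip_tail st).
  have ji : j = i by apply: agree_off_unique xt _; rewrite eq_sym newx ?mem_head.
  apply: (strip_cons (i := i) tx) => //=; first exact: agree_off_trans xt ty.
  by move=> z zq; rewrite -ji newx // inE zq orbT.
have [ta [j [aj newa]]] := strip_head st.
apply: (strip_cons (i := j) ta).
- exact: IH (strip_tail st).
- by case: (p) aj.
move=> z zs; apply: newa; move: zs; rewrite !mem_cat !inE.
by case/or3P=> -> //; rewrite ?orbT.
Qed.

(** Ranks count first occurrences. A replaced vertex does not return, so ranks at every index grow
    weakly along the strip, and a strict inequality at [i] tells which tricycle comes first. *)
Lemma strip_mono i j s : strip s -> {in s &, forall t t',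
  (index (t i) [seq z i | z : triple <- s] < index (t' i) [seq z i | z : triple <- s])%N ->
  (index (t j) [seq z j | z : triple <- s] <= index (t' j) [seq z j | z : triple <- s])%N}.
Proof.
elim: s => //= x s IH xs t t'; have {}IH := IH (strip_tail xs).
have [_ [k [xk new]]] := strip_head xs.
rewrite !inE => /orP[/eqP->|ts]; first by rewrite !eqxx.
move=> /orP[/eqP->|t's]; first by rewrite eqxx ltn0.
(* Prepending [x] raises every rank at [m] by one except that of [x m], which is 0. By [back], if
   [x m] still occurs in [s] it was first there; by [fore], if another vertex is first in [s], then
   [x m] does not occur in [s]. *)
have back m z : z \in s -> x m = z m -> index (z m) [seq z m | z : triple <- s] = 0%N.
  move=> zs xz; have mk : m != k by apply/eqP => e; have := new z zs; rewrite -e xz eqxx.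
  by move: zs (agree_offP _ _ _ xk m mk); case: (s) => //= h s' _; rewrite xz => <-; rewrite eqxx.
have fore m z : z \in s -> x m != z m ->
    index (z m) [seq z m | z : triple <- s] = 0%N -> forall z', z' \in s -> x m != z' m.
  move=> zs xz e z' z's; apply: contraNneq xz => xz'.
  have := back m z' z's xz'; move: zs e; case: (s) => //= h s' _.
  by do 2 case: eqP => // ->; move=> _ _; rewrite -xz'.
case: (eqVneq (x j) (t j)) => // xtj.
case: (eqVneq (x i) (t' i)) => // xti'.
have lt : (index (t i) [seq z i | z : triple <- s] < index (t' i) [seq z i | z : triple <- s])%N ->
    (if x j == t' j then 0 else (index (t' j) [seq z j | z : triple <- s]).+1)%N = 0%N -> False.
  move=> /(IH t t' ts t's); case: eqVneq => // xtj' + _.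
  rewrite (back j t') // leqn0 => /eqP /(fore j t ts xtj) /(_ t' t's).
  by rewrite xtj' eqxx.
have pos : x i = t i -> (0 < index (t' i) [seq z i | z : triple <- s])%N.
  move=> xti; rewrite lt0n; apply/eqP => e.
  by have := fore i t' t's xti' e t ts; rewrite xti eqxx.
case: (eqVneq (x i) (t i)) => [xti _|_ lti].
  have l : (index (t i) [seq z i | z : triple <- s] < index (t' i) [seq z i | z : triple <- s])%N.
    by rewrite (back i t) // pos.
  move: (lt l); case: (eqVneq (x j) (t' j)) => _ h; first by case: (h erefl).
  by rewrite ltnS IH.
move: (lt lti); case: (eqVneq (x j) (t' j)) => _ h; first by case: (h erefl).
by rewrite ltnS IH.
Qed.

Definition strip_edge s : rel G := fun u v =>
  has (fun t : triple => [exists k, (t k == u) && (t (k + 1) == v)]) s.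

Definition strip_verts s : {set G} :=
  [set u | has (fun t : triple => [exists k, t k == u]) s].

Lemma strip_edgeP s u v :
  reflect (exists t k, [/\ t \in s, t k = u & t (k + 1) = v]) (strip_edge s u v).
Proof.
apply: (iffP hasP) => [[t ts /existsP[k /andP[/eqP e1 /eqP e2]]]|[t [k [ts e1 e2]]]].
  by exists t, k.
by exists t => //; apply/existsP; exists k; rewrite e1 e2 !eqxx.
Qed.

Lemma strip_vertsP s u :
  reflect (exists t k, t \in s /\ t k = u) (u \in strip_verts s).
Proof.
rewrite inE; apply: (iffP hasP) => [[t ts /existsP[k /eqP e]]|[t [k [ts e]]]].
  by exists t, k.
by exists t => //; apply/existsP; exists k; rewrite e.
Qed.

Lemma strip_edge_at s t k : t \in s -> strip_edge s (t k) (t (k + 1)).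
Proof. by move=> ts; apply/strip_edgeP; exists t, k. Qed.

Lemma strip_edge_verts s u v : strip_edge s u v ->
  (u \in strip_verts s) && (v \in strip_verts s).
Proof.
case/strip_edgeP=> t [k [ts <- <-]].
by apply/andP; split; apply/strip_vertsP; [exists t, k|exists t, (k + 1)].
Qed.

Lemma strip_tricycle s t : strip s -> t \in s -> tricycle col t.
Proof. by move=> [/allP st _]; exact: st. Qed.

Lemma strip_edge_sub s : strip s -> subrel (strip_edge s) edge.
Proof.
move=> st u v /strip_edgeP[t [k [ts <- <-]]].
exact: tricycle_edge (strip_tricycle st ts).
Qed.

Lemma tricycle_connect s t i j : t \in s -> connect (strip_edge s) (t i) (t j).
Proof.
move=> ts; have c k : connect (strip_edge s) (t k) (t (k + 1)).
  by apply: connect1; exact: strip_edge_at.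
case: (Z3_cases i j) => ->; first exact: connect0.
  exact: c.
exact: connect_trans (c _) (c _).
Qed.

Lemma strip_connected s : strip s ->
  {in strip_verts s &, forall u v, connect (strip_edge s) u v}.
Proof.
move=> st u v /strip_vertsP[t [i [ts <-]]] /strip_vertsP[t' [j [t's <-]]].
elim: s st t t' ts t's i j => // x s IH xs t t'.
have {}IH := IH (strip_tail xs).
have mono a b : connect (strip_edge s) a b -> connect (strip_edge (x :: s)) a b.
  by apply: connect_sub => c d cd; apply: connect1; rewrite /strip_edge /= [has _ _]cd orbT.
have [_ [k [xk new]]] := strip_head xs.
have key z : z \in s -> exists m, x (k + 1) = head x s (k + 1) /\ head x s \in s /\ m = z.
  move=> zs; exists z; rewrite (agree_offP _ _ _ xk) ?Z3_neq1 //.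
  by case: (s) zs => // h s' _; rewrite /= mem_head.
have xx : x \in x :: s by rewrite mem_head.
rewrite !inE => /orP[/eqP->|ts] /orP[/eqP->|t's] i j.
- exact: tricycle_connect.
- have [_ [e [hs _]]] := key _ t's.
  apply: connect_trans (tricycle_connect i (k + 1) xx) _.
  by rewrite e; apply: mono; exact: IH.
- have [_ [e [hs _]]] := key _ ts.
  apply: connect_trans _ (tricycle_connect (k + 1) j xx).
  by rewrite e; apply: mono; exact: IH.
- exact: mono (IH _ _ _ _ _ _).
Qed.

(** The link of [h] in the complex of the strip's triangles, as an undirected graph: the edges
    opposite to [h], whose index is [k]. *)
Definition link s (k : 'Z_3) (h : G) : rel G := fun u v =>
  has (fun t : triple => (t k == h) &&
    ((t (k + 1) == u) && (t (k + 1 + 1) == v) || (t (k + 1) == v) && (t (k + 1 + 1) == u))) s.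

Lemma linkP s k h u v :
  reflect (exists t, [/\ t \in s, t k = h &
    t (k + 1) = u /\ t (k + 1 + 1) = v \/ t (k + 1) = v /\ t (k + 1 + 1) = u])
    (link s k h u v).
Proof.
apply: (iffP hasP) => [[t ts /andP[/eqP e /orP[]/andP[/eqP e1 /eqP e2]]]|[t [ts e e12]]].
- by exists t; split=> //; left.
- by exists t; split=> //; right.
by exists t => //; rewrite e eqxx /=; case: e12 => -[-> ->]; rewrite !eqxx ?orbT.
Qed.

Lemma link_sym s k h : symmetric (link s k h).
Proof. by move=> u v; apply: eq_has => t; congr (_ && _); exact: orbC. Qed.

(** The tricycles at [h] are consecutive, and two successive ones share a second vertex, at which
    their opposite edges meet. *)
Lemma link_connected s k h t t' : strip s -> t \in s -> t' \in s -> t k = h -> t' k = h ->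
  connect (link s k h) (t (k + 1)) (t' (k + 1 + 1)).
Proof.
have sym s' : connect_sym (link s' k h) by apply: sym_connect_sym; exact: link_sym.
have opp s' z : z \in s' -> z k = h -> connect (link s' k h) (z (k + 1)) (z (k + 1 + 1)).
  by move=> zs zk; apply/connect1/linkP; exists z; split=> //; left.
suff main s' : strip s' -> {in s' &, forall t t', t k = h -> t' k = h ->
    connect (link s' k h) (t (k + 1)) (t' (k + 1))}.
  move=> st ts t's tk t'k; exact: connect_trans (main s st t t' ts t's tk t'k) (opp _ _ t's t'k).
elim: s' {s t t'} => // x s IH xs.
have {}IH := IH (strip_tail xs).
have mono a b : connect (link s k h) a b -> connect (link (x :: s) k h) a b.
  by apply: connect_sub => c d cd; apply: connect1; rewrite /link /= [has _ _]cd orbT.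
have [_ [m [xm new]]] := strip_head xs.
have xx : x \in x :: s by rewrite mem_head.
have key z : z \in s -> z k = h -> x k = h ->
    connect (link (x :: s) k h) (x (k + 1)) (z (k + 1)).
  move=> zs zk xk; have km : k != m.
    by apply/eqP => e; have := new z zs; rewrite -e xk zk eqxx.
  have hs : head x s \in s by case: (s) zs => // h' s' _; rewrite /= mem_head.
  have hk : head x s k = h by rewrite -(agree_offP _ _ _ xm k km).
  have hxs : head x s \in x :: s by rewrite inE hs orbT.
  have c := mono _ _ (IH _ _ hs zs hk zk).
  have [m1|m1] := eqVneq m (k + 1); last first.
    by rewrite (agree_offP _ _ _ xm (k + 1)) // eq_sym.
  apply: connect_trans (opp _ _ xx xk) _.
  rewrite (agree_offP _ _ _ xm (k + 1 + 1)) ?m1 ?Z3_neq12 //.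
  by apply: connect_trans c; rewrite sym; exact: opp.
move=> t t'; rewrite !inE => /orP[/eqP->|ts] /orP[/eqP->|t's] tk t'k.
- exact: connect0.
- exact: key.
- by rewrite sym; exact: key.
- exact: mono (IH _ _ _ _ _ _).
Qed.

End Strips.

(** * Diwheels and branchers *)

Section Diwheel.
Variables (G : digraph) (col : G -> 'Z_3).
Hypothesis hcol : forall u v : G, edge u v -> col v = col u + 1.

Definition adj (u v : G) := edge u v || edge v u.

Section Rim.
Variables (h : G) (c : seq G).
Hypotheses (uc : uniq c) (sc : (4 <= size c)%N) (evc : ~~ odd (size c)).
Hypothesis hub : {in c, forall x, adj x h}.
Hypothesis rim : cycle adj c.

Let Hv : finType := {x : G | x \in h :: c}.
(** The restriction to [wheel_adj] discards chords that the rim may have in [G]. *)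
Definition wheel_edge : rel Hv := fun x y =>
  edge (val x) (val y) && wheel_adj h c (val x) (val y).

Lemma wheel_edge_irr : irreflexive wheel_edge.
Proof. by move=> x; rewrite /wheel_edge edge_irr. Qed.

Definition wheel : digraph := Digraph wheel_edge_irr.

Lemma adj_sym u v : adj u v = adj v u.
Proof. by rewrite /adj orbC. Qed.

Lemma wheel_adj_sym u v : wheel_adj h c u v = wheel_adj h c v u.
Proof. by rewrite /wheel_adj orbCA (andbCA (u \in c)) (orbC (_ == _)). Qed.

Lemma wheel_adj_adj u v : wheel_adj h c u v -> adj u v.
Proof.
have nx x : x \in c -> adj x (next c x) by exact: next_cycle.
case/or3P=> [/andP[/eqP-> /hub]|/andP[/eqP-> /hub]|/and3P[uC vC /orP[]/eqP->]] //.
- by rewrite adj_sym.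
- exact: nx.
- by rewrite adj_sym; exact: nx.
Qed.

(** Every edge raises the colour by one, so no edge has both directions, and three pairwise adjacent
    vertices cannot be oriented transitively. *)
Lemma wheel_is_diwheel : is_diwheel wheel.
Proof.
have hc : h \notin c.
  by apply/negP => /hub; rewrite /adj edge_irr.
have lift : forall s, {subset s <= h :: c} -> exists s' : seq Hv, map val s' = s.
  elim=> [|a s IH] sub; first by exists [::].
  have [|s' <-] := IH; first by move=> x xs; apply: sub; rewrite inE xs orbT.
  by exists (exist _ a (sub a (mem_head _ _)) :: s').
have [c' cE] : exists c' : seq Hv, map val c' = c.
  by apply: lift => x xc; rewrite inE xc orbT.
pose v : Hv := exist _ h (mem_head _ _).
have uc' : uniq c' by rewrite -(map_inj_uniq val_inj) cE.
have inc (x : Hv) : (x \in c') = (val x \in c) by rewrite -(mem_map val_inj) cE.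
have nxt (x : Hv) : val (next c' x) = next c (val x).
  by rewrite -(next_map val_inj uc') cE.
have wadj (x y : Hv) : wheel_adj v c' x y = wheel_adj h c (val x) (val y).
  by rewrite /wheel_adj !inc -!(inj_eq val_inj) !nxt.
have anti (x y : wheel) : ~~ (edge x y && edge y x).
  apply/negP => /andP[/andP[/hcol e1 _] /andP[/hcol e2 _]].
  by have := Z3_neq2 (col (val x)); rewrite -e1 -e2 eqxx.
have und (x y : wheel) : edge x y || edge y x = wheel_adj v c' x y.
  rewrite wadj /edge /= /wheel_edge (wheel_adj_sym (val y)) -andb_orl.
  by case: (boolP (wheel_adj _ _ _ _)) => [/wheel_adj_adj|]; rewrite ?andbT ?andbF.
exists v, c'; split=> //.
- by rewrite -(size_map val) cE sc evc.
- split; first by rewrite /= uc' inc /= hc.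
  by move=> [x xs] /=; rewrite inE -(inj_eq val_inj) inc /= -in_cons.
move=> x xc.
have nc : next c' x \in c' by rewrite mem_next.
have e1 : edge (x : wheel) (next c' x) || edge (next c' x : wheel) x.
  by rewrite und /wheel_adj xc nc eqxx ?orbT.
have e2 : edge (x : wheel) v || edge (v : wheel) x by rewrite und /wheel_adj eqxx xc !orbT.
have e3 : edge (next c' x : wheel) v || edge (v : wheel) (next c' x).
  by rewrite und /wheel_adj eqxx nc !orbT.
have wcol (a b : wheel) : edge a b -> col (val b) = col (val a) + 1.
  by move=> /andP[/hcol].
have ne (a b : wheel) : edge a b || edge b a -> a != b.
  by apply: contraTneq => ->; rewrite edge_irr.
rewrite /forms_tricycle /ucycleb /= !inE !andbT !negb_or.
rewrite (ne _ _ e1) (ne _ _ e2) (ne _ _ e3) (eq_sym (v : wheel)) (ne _ _ e3) /= !andbT.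
have trans (a b d : wheel) : edge a b -> edge b d -> edge a d -> False.
  move=> /wcol ab /wcol bd /wcol ad; have := Z3_neq1 (col (val a) + 1).
  by rewrite -{1}ab -bd ad eqxx.
apply/orP; case/orP: e1 => e1; case/orP: e2 => e2; case/orP: e3 => e3.
- by case: (trans _ _ _ e1 e3 e2).
- by case: (trans _ _ _ e2 e3 e1).
- by left; apply/and3P; split.
- by case: (trans _ _ _ e2 e1 e3).
- by case: (trans _ _ _ e1 e2 e3).
- by right; apply/and3P; split.
- by case: (trans _ _ _ e3 e2 e1).
- by case: (trans _ _ _ e3 e1 e2).
Qed.

Lemma contains_wheel : contains G wheel.
Proof.
by exists val; split=> [|x y /andP[]//]; exact: val_inj.
Qed.

End Rim.
End Diwheel.

Lemma uniq_reindex (T : eqType) (x0 : T) (vs : seq T) (idx : seq nat) :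
  uniq vs -> uniq idx -> all (fun i => i < size vs)%N idx ->
  uniq [seq nth x0 vs i | i <- idx].
Proof.
move=> uvs uidx /allP lt; rewrite map_inj_in_uniq // => i j /lt li /lt lj /eqP.
by rewrite nth_uniq // => /eqP.
Qed.

Section Obstruct.
Variables (G : digraph) (col : G -> 'Z_3).
Hypothesis hcyc : three_cyclic G.
Hypothesis hcol : forall u v : G, edge u v -> col v = col u + 1.
Local Notation triple := {ffun 'Z_3 -> G}.

(** The link of [h] contains a path from [w] to [u], which the edge [wu] closes to a rim with hub
    [h]. Colours alternate along the link and those of [w] and [u] differ, so the rim is even; it
    has at least four vertices because [wu] is not on the strip. *)
Lemma strip_diwheel (s : seq triple) (u h w : G) : strip col s ->
  strip_edge s u h -> strip_edge s h w -> edge w u -> ~~ strip_edge s w u ->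
  exists H, is_diwheel H /\ contains G H.
Proof.
move=> st /strip_edgeP[t1 [k1 [t1s t1u t1h]]] /strip_edgeP[t2 [k [t2s t2h t2w]]] wu nwu.
have kc t i : t \in s -> col (t i) = i by move=> ts; exact: tricycle_col (strip_tricycle st ts).
have ek : k1 + 1 = k by rewrite -(kc t1 (k1 + 1)) // t1h -t2h kc.
rewrite ek in t1h.
have {}t1u : t1 (k + 1 + 1) = u by rewrite -ek Z3_add3.
have := link_connected st t2s t1s t2h t1h; rewrite t2w t1u.
case/connectP=> p0 p0p; case/shortenP: p0p => p pp up _ lp.
have lk a b : link s k h a b ->
    [/\ adj a b, adj a h & (col a == k + 1) = (col b != k + 1)] /\
    [/\ (col a == k + 1) || (col a == k + 1 + 1), adj b h & a != h].
  case/linkP=> t [ts tk ab].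
  have te i : edge (t i) (t (i + 1)) by exact: tricycle_edge (strip_tricycle st ts).
  have ck1 := kc _ (k + 1) ts; have ck2 := kc _ (k + 1 + 1) ts.
  have nh i : i != k -> t i != h.
    by move=> ik; rewrite -tk; apply: contra ik => /eqP e; rewrite -(kc t i ts) e kc.
  have a1 := te (k + 1); have a2 := te k; have a3 := te (k + 1 + 1).
  rewrite Z3_add3 tk in a3; rewrite tk in a2.
  by case: ab => -[<- <-]; rewrite /adj ck1 ck2 a1 a2 a3 !eqxx ?orbT Z3_neq1 ?nh ?Z3_neq1 ?Z3_neq2.
have ecw : col w = k + 1 by rewrite -t2w kc.
have ecu : col u = k + 1 + 1 by rewrite -t1u kc.
have par : forall q a, path (link s k h) a q -> (col (last a q) == k + 1) = ((col a == k + 1) (+) odd (size q)).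
  elim=> [|b q IH] a /=; first by rewrite addbF.
  by move=> /andP[/lk[[_ _ e] _] /IH->]; rewrite e addbN addNb negbK.
have oddp : odd (size p).
  have := par _ _ pp; rewrite -lp ecu ecw eqxx Z3_neq1.
  by case: (odd _).
have sp : (2 < size p)%N.
  case: p pp lp oddp {up} => [|a [|b [|c p]]] //= ; rewrite andbT => /linkP[t [ts tk wa]] e _.
  case: wa; rewrite -{}e => -[e1 e2].
    by case/negP: nwu; apply/strip_edgeP; exists t, (k + 1).
  by move: ecu; rewrite -e1 kc // => /esym/eqP; rewrite Z3_neq1.
have cyc : cycle (@adj G) (w :: p).
  rewrite /= rcons_path -lp /adj wu orbT andbT.
  by apply: sub_path pp => a b /lk[[]].
have hub : {in w :: p, forall x, adj x h}.
  move=> x; rewrite inE => /orP[/eqP->|].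
    by case: p pp sp {lp up oddp cyc} => //= a p /andP[/lk[[]]].
  clear -pp lk; elim: p w pp => //= a p IH w /andP[/lk[_ [_ ah _]] ap].
  by rewrite inE => /orP[/eqP->//|]; exact: IH ap.
exists (wheel h (w :: p)); split; last exact: contains_wheel.
by apply: (wheel_is_diwheel hcol up) => //=; rewrite ?negbK.
Qed.

Lemma contains_list_edge (n : nat) (es : seq (nat * nat)) (irr : irreflexive (@list_edge n es))
    (vs : n.-tuple G) (x0 : G) : uniq vs ->
  all (fun e => edge (nth x0 vs e.1) (nth x0 vs e.2)) es -> contains G (Digraph irr).
Proof.
move=> uvs /allP ed; exists (fun i : 'I_n => nth x0 vs i); split=> [i j e|i j /ed//].
by apply/val_inj/eqP; rewrite -(nth_uniq x0 _ _ uvs) ?size_tuple ?ltn_ord //; exact/eqP.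
Qed.

Lemma contains_reverse_list_edge (n : nat) (es : seq (nat * nat)) (irr : irreflexive (@list_edge n es))
    (vs : n.-tuple G) (x0 : G) : uniq vs ->
  all (fun e => edge (nth x0 vs e.2) (nth x0 vs e.1)) es -> contains G (reverse (Digraph irr)).
Proof.
move=> uvs /allP ed; exists (fun i : 'I_n => nth x0 vs i); split=> [i j e|i j /ed//].
by apply/val_inj/eqP; rewrite -(nth_uniq x0 _ _ uvs) ?size_tuple ?ltn_ord //; exact/eqP.
Qed.

(** [b] completes a second tricycle on the edge [ya], or, for a false flag, on the edge [ax]. *)
Definition leg (x y : G) (f : bool) (a b : G) : bool :=
  if f then edge a b && edge b y else edge x b && edge b a.

(* Equal flags give the first digraph of the branchers, mixed flags the second;
   if the majority of the flags is false, it is reversed, with x and y swapped. *)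
Lemma three_legs (x y a1 a2 a3 b1 b2 b3 : G) (f1 f2 f3 : bool) :
  uniq [:: x; y; a1; a2; a3; b1; b2; b3] -> edge x y ->
  [/\ edge y a1, edge y a2 & edge y a3] -> [/\ edge a1 x, edge a2 x & edge a3 x] ->
  [/\ leg x y f1 a1 b1, leg x y f2 a2 b2 & leg x y f3 a3 b3] ->
  exists H, is_brancher H /\ contains G H.
Proof.
move=> u xy [ya1 ya2 ya3] [ax1 ax2 ax3].
(* Two of three flags agree; the legs are permuted so that these come first. *)
wlog f12 : a1 a2 a3 b1 b2 b3 f1 f2 f3 u ya1 ya2 ya3 ax1 ax2 ax3 / f1 == f2.
  move=> W l; have [l1 l2 l3] := l.
  case: (eqVneq f1 f2) => [/eqP e|n12]; first exact: (W a1 a2 a3 b1 b2 b3 f1 f2 f3).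
  case: (eqVneq f1 f3) => [/eqP e|n13].
    apply: (W a1 a3 a2 b1 b3 b2 f1 f3 f2) => //.
    exact: (uniq_reindex x (idx := [:: 0; 1; 2; 4; 3; 5; 7; 6]%N) u).
  apply: (W a2 a3 a1 b2 b3 b1 f2 f3 f1) => //.
    exact: (uniq_reindex x (idx := [:: 0; 1; 3; 4; 2; 6; 7; 5]%N) u).
  by move: n12 n13; case: f1 f2 f3 {l l1 l2 l3 W} => [] [] [].
have u' : uniq [:: y; x; a1; a2; a3; b1; b2; b3].
  exact: (uniq_reindex x (idx := [:: 1; 0; 2; 3; 4; 5; 6; 7]%N) u).
move: f12; case: f1 f2 f3 => [] [] // [] _; rewrite /leg => -[] /andP[l11 l12] /andP[l21 l22] /andP[l31 l32].
- exists brancher1; split; first by constructor 1.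
  apply: (@contains_list_edge 8 _ _ [tuple x; y; a1; a2; a3; b1; b2; b3] x) => //.
  by rewrite /= xy ya1 ya2 ya3 ax1 ax2 ax3 l11 l12 l21 l22 l31 l32.
- exists brancher2; split; first by constructor 2.
  apply: (@contains_list_edge 8 _ _ [tuple x; y; a1; a2; a3; b1; b2; b3] x) => //.
  by rewrite /= xy ya1 ya2 ya3 ax1 ax2 ax3 l11 l12 l21 l22 l31 l32.
- exists (reverse brancher2); split; first by constructor 4.
  apply: (@contains_reverse_list_edge 8 _ _ [tuple y; x; a1; a2; a3; b1; b2; b3] x) => //.
  by rewrite /= xy ya1 ya2 ya3 ax1 ax2 ax3 l11 l12 l21 l22 l31 l32.
- exists (reverse brancher1); split; first by constructor 3.
  apply: (@contains_reverse_list_edge 8 _ _ [tuple y; x; a1; a2; a3; b1; b2; b3] x) => //.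
  by rewrite /= xy ya1 ya2 ya3 ax1 ax2 ax3 l11 l12 l21 l22 l31 l32.
Qed.

(** Otherwise [t 2, n 0, t 1, n 2, t 0, n 1] would be a directed cycle of length six. *)
Lemma no_three_replacements (t : triple) (n : 'Z_3 -> G) : tricycle col t ->
  (forall i, edge (t (i + 1 + 1)) (n i) && edge (n i) (t (i + 1))) ->
  exists i, n i = t i.
Proof.
move=> tt ne; apply: contrapT => none.
have nt i : n i != t i by apply/eqP => e; apply: none; exists i.
have tc i := tricycle_col i tt.
have nc i : col (n i) = i.
  by have /andP[/hcol-> _] := ne i; rewrite tc Z3_add3.
have dt i j : i != j -> t i != t j by apply: contra => /eqP e; rewrite -(tc i) e tc.
have dn i j : i != j -> n i != n j by apply: contra => /eqP e; rewrite -(nc i) e nc.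
have dx i j : n i != t j.
  have [<-|ij] := eqVneq i j; first exact: nt.
  by apply: contra ij => /eqP e; rewrite -(nc i) e tc.
have E i : edge (t (i + 1 + 1)) (n i) /\ edge (n i) (t (i + 1)) by have /andP[] := ne i.
have [e00 e01] := E 0; have [e10 e11] := E 1; have [e20 e21] := E (1 + 1).
rewrite (_ : 1 + 1 + 1 = 0 :> 'Z_3) in e10 e21; last by apply/eqP.
rewrite (_ : 1 + 1 + 1 + 1 = 1 :> 'Z_3) in e20; last by apply/eqP.
rewrite !add0r in e00 e01.
have := no_hexagon hcyc e00 e01 e20 e21 e10 e11.
by rewrite /= !inE !negb_or !(eq_sym (t _) (n _)) !dx !dt // !dn.
Qed.

End Obstruct.

(** * Longest strips *)

Lemma last_switch (T : Type) (P : pred T) (p : seq T) (z : T) : P z -> ~~ all P (rcons p z) ->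
  exists p1 a b p2, [/\ rcons p z = p1 ++ a :: b :: p2, ~~ P a & P b].
Proof.
move=> Pz; elim: p => [|a p IH] /=; first by rewrite Pz.
case: (boolP (all P (rcons p z))) => [al|/IH [p1 [c [d [p2 [-> nc Pd]]]]] _].
  rewrite andbT => na; case: p {IH} al => [|b p] /= al; first by exists [::], a, z, [::].
  by case/andP: al => Pb _; exists [::], a, b, (rcons p z).
by exists (a :: p1), c, d, p2.
Qed.

Section Maximal.
Variables (G : digraph) (col : G -> 'Z_3).
Hypothesis hcyc : three_cyclic G.
Hypothesis hcol : forall u v : G, edge u v -> col v = col u + 1.
Local Notation triple := {ffun 'Z_3 -> G}.
Implicit Types (s p q : seq triple) (t x y : triple).

Lemma strip_cut_at c p x y q : strip col (rcons p x ++ y :: q) -> agree_off c x y ->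
  {in rcons p x & y :: q, forall t t', t c != t' c}.
Proof.
move=> /strip_cut [j [xy sep]] xyc.
suff <- : j = c by [].
by apply: agree_off_unique xyc _; apply: sep; rewrite ?mem_rcons ?mem_head.
Qed.

(** [k'] and [k] are neighbours in the strip where agreement with [y] off [c] sets in. So [k] has
    the base edge of [y] and apex [k c], and [k'] replaces an end of the base, which makes [k' d]
    the end of a leg. *)
Lemma strip_leg c p x y q : strip col (rcons p x ++ y :: q) -> agree_off c x y ->
  ~~ all (fun z => agree_off c z y) (rcons p x) ->
  exists k k' d, [/\ k \in rcons p x, k' \in rcons p x, agree_off c k y, agree_off d k' k &
    [/\ d != c, k' d != k d & {in y :: q, forall z : triple, k' d != z d}]].
Proof.
move=> st xy /(last_switch (P := fun z => agree_off c z y) xy)[p1 [k' [k [p2 [e nk' kc]]]]].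
rewrite e -catA /= -cat_rcons in st; rewrite e.
have [d [k'k sep]] := strip_cut st.
exists k, k', d; split=> //.
- by rewrite mem_cat !inE eqxx !orbT.
- by rewrite mem_cat !inE eqxx !orbT.
split; first by apply: contra nk' => /eqP dc; rewrite -dc in kc *; exact: agree_off_trans k'k kc.
- by apply: sep; rewrite ?mem_rcons ?mem_head.
- by move=> z zy; apply: sep; rewrite ?mem_rcons ?mem_head // inE mem_cat zy !orbT.
Qed.

Lemma strip_move_front c i p x t y q t' : strip col (rcons p x ++ t :: y :: q) ->
  agree_off c x t -> agree_off c t y -> all (fun z => agree_off c z t) (rcons p x) ->
  tricycle col t' -> agree_off i t' t ->
  {in rcons p x ++ t :: y :: q, forall z : triple, z i != t' i} ->
  strip col (t' :: t :: rcons p x ++ y :: q).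
Proof.
move=> st xt ty al tt' t't new.
have tt : tricycle col t by apply: (strip_tricycle st); rewrite mem_cat mem_head orbT.
apply: (strip_cons (i := i)) => //; last first.
  move=> z; rewrite inE mem_cat => zs; apply: new; rewrite mem_cat inE.
  by case/or3P: zs => ->; rewrite ?orbT.
apply: (strip_cons (i := c)) => //.
- by move: st; rewrite !cat_rcons => st; exact: strip_remove st xt ty.
- rewrite agree_off_sym; case: p al {st new} => [|a p] /=; first by rewrite andbT.
  by case/andP.
- move=> z; rewrite mem_cat => /orP[zp|zq].
    by apply: (strip_cut_at st xt) => //; rewrite mem_head.
  rewrite eq_sym; move: st; rewrite -cat_rcons => st.
  by apply: (strip_cut_at st ty) => //; rewrite mem_rcons mem_head.
Qed.

(** If [t0] is an end of the strip, [t] is put beyond it, after a reversal if needed. If a neighbour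
    of [t0] also differs from it at [i], then [t] fits between them. The remaining cases depend on
    whether the two neighbours differ from [t0] at the same index. *)
Lemma strip_extend i s t0 t : strip col s -> t0 \in s -> tricycle col t ->
  agree_off i t t0 -> {in s, forall z : triple, z i != t i} ->
  (exists2 s', strip col s' & (size s < size s')%N) \/
  (exists H, is_brancher H /\ contains G H).
Proof.
move=> + t0s; case/splitPr: t0s => p q st tt tt0 new.
have tt0' := tt0; rewrite agree_off_sym in tt0'.
have front s' x : strip col (x :: s') -> agree_off i t x ->
    {in x :: s', forall z : triple, z i != t i} -> strip col (t :: x :: s').
  by move=> sx tx nx; apply: (strip_cons (i := i)).
case/lastP: p st new => [|p x] st new.
  by left; exists (t :: t0 :: q) => //; apply: front.
case: q st new => [|y q] st new.
  left; exists (t :: rev (rcons p x ++ [:: t0])); last by rewrite /= size_rev.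
  have := strip_rev st; rewrite rev_cat /= => st'; apply: front => // z.
  by rewrite -[_ :: _]/([:: t0] ++ _) -[[:: t0]]/(rev [:: t0]) -rev_cat mem_rev; exact: new.
(* [t0] differs from its neighbours [x], [y] of the strip at c1 and at c2. *)
have [c1 [xt0 _]] := strip_cut st.
have st2 : strip col (rcons (rcons p x) t0 ++ y :: q) by rewrite cat_rcons.
have [c2 [t0y _]] := strip_cut st2.
have sep1 := strip_cut_at st xt0; have sep2 := strip_cut_at st2 t0y.
have [c1i|c1i] := eqVneq c1 i.
  rewrite {c1}c1i in xt0 sep1 *.
  left; exists (p ++ x :: t :: t0 :: y :: q); last by rewrite cat_rcons !size_cat /= !addnS.
  rewrite cat_rcons in st new; apply: (strip_insert st tt _ xt0 new).
  exact: agree_off_trans xt0 tt0'.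
have [c2i|c2i] := eqVneq c2 i.
  rewrite {c2}c2i in t0y sep2 *.
  left; exists (rcons p x ++ t0 :: t :: y :: q); last by rewrite !size_cat /= !addnS.
  exact: (strip_insert st tt tt0' t0y new).
have xs : x \in rcons p x ++ t0 :: y :: q by rewrite mem_cat mem_rcons mem_head.
have ys : y \in rcons p x ++ t0 :: y :: q by rewrite mem_cat !inE eqxx !orbT.
have t0s : t0 \in rcons p x ++ t0 :: y :: q by rewrite mem_cat mem_head orbT.
have xp : x \in rcons p x by rewrite mem_rcons mem_head.
have tt00 := strip_tricycle st t0s.
have repl (z : triple) j : tricycle col z -> agree_off j z t0 ->
    edge (t0 (j + 1 + 1)) (z j) && edge (z j) (t0 (j + 1)).
  move=> tz /agree_offP zt; have := tricycle_edge j tz; have := tricycle_edge (j + 1 + 1) tz.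
  by rewrite Z3_add3 (zt (j + 1)) ?Z3_neq1 // (zt (j + 1 + 1)) ?Z3_neq2 // => -> ->.
have [c12|c12] := eqVneq c1 c2; last first.
  (* Each of the three vertices of [t0] is replaced in one of [t], [x], [y]. *)
  pose n j := if j == i then t j else if j == c1 then x j else y j.
  have cj j : j != i -> j != c1 -> j = c2.
    case: (i) (c1) (c2) (j) c1i c2i c12 => [[|[|[|//]]] ?] [[|[|[|//]]] ?] [[|[|[|//]]] ?] [[|[|[|//]]] ?] //= _ _ _ _ _;
    by apply/val_inj.
  have [|j] := @no_three_replacements G col hcyc hcol t0 n tt00.
    move=> j; rewrite /n; case: (eqVneq j i) => [->|ji]; first exact: repl.
    case: (eqVneq j c1) => [->|jc1]; first by apply: repl => //; exact: strip_tricycle st xs.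
    rewrite (cj j ji jc1); apply: repl; first exact: strip_tricycle st ys.
    by rewrite agree_off_sym.
  rewrite /n; case: (eqVneq j i) => [->|ji] e.
    by have := new t0 t0s; rewrite e eqxx.
  move: e; case: (eqVneq j c1) => [-> e|jc1].
    by have := sep1 x t0 xp (mem_head _ _); rewrite e eqxx.
  rewrite (cj j ji jc1) => e.
  by have := sep2 t0 y; rewrite e eqxx mem_rcons !mem_head => /(_ isT isT).
rewrite -{c2}c12 in t0y sep2 c2i; rename c1 into c.
(* Now [t0 c] is a vertex of no other tricycle. If all tricycles on one side of
   [t0] contain the remaining edge of [t0], then [t0] may be moved to that end of
   the strip and followed by [t]; otherwise that edge is on three tricycles which
   extend in different ways, and this is a brancher. *)
case: (boolP (all (fun z => agree_off c z t0) (rcons p x))) => [al|nal].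
  left; exists (t :: t0 :: rcons p x ++ y :: q); last by rewrite /= !size_cat /= !addnS.
  exact: strip_move_front xt0 t0y al tt tt0 new.
have strv : strip col (rcons (rev q) y ++ t0 :: x :: rev p).
  by have := strip_rev st; rewrite rev_cat !rev_cons rev_rcons cat_rcons.
case: (boolP (all (fun z => agree_off c z t0) (rcons (rev q) y))) => [al|nal'].
  left; exists (t :: t0 :: rcons (rev q) y ++ x :: rev p).
    apply: (strip_move_front strv _ _ al tt tt0); try by rewrite agree_off_sym.
    move=> z zs; apply: new; move: zs; rewrite !mem_cat !inE !mem_rcons !inE !mem_rev.
    by case/or3P=> [/orP[]||/orP[]] ->; rewrite ?orbT.
  by rewrite /= !size_cat !size_rcons /= !size_rev !addnS !addSn (addnC (size q)).
have [k1 [k1' [d1 [k1p k1'p k1t k1k [d1c d1k d1q]]]]] := strip_leg st xt0 nal.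
have yt0 : agree_off c y t0 by rewrite agree_off_sym.
have [k3 [k3' [d3 [k3p k3'p k3t k3k [d3c d3k d3q]]]]] := strip_leg strv yt0 nal'.
have {}k3p : k3 \in y :: q by move: k3p; rewrite mem_rcons !inE mem_rev.
have {}k3'p : k3' \in y :: q by move: k3'p; rewrite mem_rcons !inE mem_rev.
right.
have inp z : z \in rcons p x -> z \in rcons p x ++ t0 :: y :: q by rewrite mem_cat => ->.
have inq z : z \in y :: q -> z \in rcons p x ++ t0 :: y :: q.
  by move=> zq; rewrite mem_cat inE zq !orbT.
have T1 := strip_tricycle st (inp _ k1p); have T1' := strip_tricycle st (inp _ k1'p).
have T3 := strip_tricycle st (inq _ k3p); have T3' := strip_tricycle st (inq _ k3'p).
have mkleg (k k' : triple) d : tricycle col k' -> agree_off c k t0 -> agree_off d k' k -> d != c ->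
    leg (t0 (c + 1)) (t0 (c + 1 + 1)) (d == c + 1) (k c) (k' d).
  move=> tk' /agree_offP kt /agree_offP k'k dc.
  have E := tricycle_edge (t := k') ^~ tk'.
  case: (Z3_cases c d) dc k'k => ->; first by rewrite eqxx.
    move=> _ k'k; rewrite eqxx /leg.
    have := E c; have := E (c + 1); rewrite (k'k c) 1?eq_sym ?Z3_neq1 //.
    by rewrite (k'k (c + 1 + 1)) ?Z3_neq12 // kt ?Z3_neq2 // => -> ->.
  move=> _ k'k; rewrite Z3_neq12 /leg.
  have := E (c + 1 + 1); have := E (c + 1); rewrite Z3_add3 (k'k c) 1?eq_sym ?Z3_neq2 //.
  by rewrite (k'k (c + 1)) 1?eq_sym ?Z3_neq12 // kt ?Z3_neq1 // => -> ->.
have apex (k : triple) : tricycle col k -> agree_off c k t0 ->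
    edge (t0 (c + 1 + 1)) (k c) && edge (k c) (t0 (c + 1)) by exact: repl.
(* Vertices at different indices have different colours, so only equal indices need an argument. *)
have ne (z z' : triple) e e' : tricycle col z -> tricycle col z' ->
    (e = e' -> z e != z' e') -> z e != z' e'.
  move=> tz tz' h; have [/h//|ee] := eqVneq e e'.
  by apply: contra ee => /eqP E; rewrite -(tricycle_col e tz) E tricycle_col.
have nbase (k k' : triple) d e : tricycle col k -> tricycle col k' -> agree_off c k t0 ->
    k' d != k d -> e != c -> k' d != t0 e.
  move=> tk tk' /agree_offP kt kd ec; rewrite -kt //.
  by apply: ne => // de; rewrite -de.
have ic : i != c by rewrite eq_sym.
have [ya1 ax1] := andP (apex _ T1 k1t).
have [ya2 ax2] := andP (apex _ tt00 (agree_offxx c t0)).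
have [ya3 ax3] := andP (apex _ T3 k3t).
(* The base is the edge of [t0] opposite to [t0 c], and [k1], [t0], [k3] are three tricycles on it.
   Each flag records which end of the base the leg replaces. *)
apply: (@three_legs G (t0 (c + 1)) (t0 (c + 1 + 1)) (k1 c) (t0 c) (k3 c) (k1' d1) (t i) (k3' d3)
  (d1 == c + 1) (i == c + 1) (d3 == c + 1)); [|exact: (tricycle_edge (c + 1) tt00)|by []|by []|]; last first.
  have cc := agree_offxx c t0.
  by split; [exact: (mkleg k1)|exact: (mkleg t0)|exact: (mkleg k3)].
have c1c : c + 1 != c by rewrite Z3_neq1.
have c2c : c + 1 + 1 != c by rewrite Z3_neq2.
have tn0 : t i != t0 i by rewrite eq_sym; exact: new.
have n13 : k1' d1 != k3' d3.
  by apply: ne => // <-; apply: d1q; rewrite inE k3'p orbT.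
have n1t : k1' d1 != t i by apply: ne => // ->; apply: new; exact: inp.
have n3t : t i != k3' d3 by apply: ne => // <-; rewrite eq_sym new // inq.
have ap (z z' : triple) e : tricycle col z -> tricycle col z' -> e != c -> z c != z' e.
  by move=> tz tz' ec; apply: ne => // ce; rewrite -ce eqxx in ec.
have a12 : k1 c != t0 c by apply: sep1; rewrite ?mem_head.
have a13 : k1 c != k3 c by apply: sep1; rewrite // inE k3p orbT.
have a23 : t0 c != k3 c by apply: sep2; rewrite ?mem_rcons ?mem_head.
have b1 e : e != c -> t0 e != k1' d1 by move=> ec; rewrite eq_sym; apply: (nbase k1).
have b3 e : e != c -> t0 e != k3' d3 by move=> ec; rewrite eq_sym; apply: (nbase k3).
have b2 e : e != c -> t0 e != t i.
  by move=> ec; rewrite eq_sym; apply: (nbase t0) => //; exact: agree_offxx.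
have a0 e (z : triple) : e != c -> tricycle col z -> t0 e != z c.
  by move=> ec tz; rewrite eq_sym ap.
have xy : t0 (c + 1) != t0 (c + 1 + 1).
  by apply: (ne _ _ _ _ tt00 tt00) => /eqP; rewrite eq_sym Z3_neq12.
rewrite /= !inE !negb_or xy a12 a13 a23 n1t n13 n3t.
by rewrite !(a0 (c + 1)) // !(a0 (c + 1 + 1)) // !(b1 (c + 1)) // !(b1 (c + 1 + 1)) // !(b2 (c + 1)) //
  !(b2 (c + 1 + 1)) // !(b3 (c + 1)) // !(b3 (c + 1 + 1)) // !ap.
Qed.

End Maximal.

(** * The order along a longest strip *)

Section Sufficiency.
Variable G : digraph.
Hypothesis hcyc : three_cyclic G.
Hypothesis nodiwheel : forall H, is_diwheel H -> ~ contains G H.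
Hypothesis nobrancher : forall H, is_brancher H -> ~ contains G H.
Variable col : G -> 'Z_3.
Hypothesis hcol : forall u v : G, edge u v -> col v = col u + 1.
Local Notation triple := {ffun 'Z_3 -> G}.

Lemma max_strip_closed (s : seq triple) : strip col s ->
  (forall s', strip col s' -> (size s' <= size s)%N) ->
  tri_closed col (strip_edge s).
Proof.
move=> st smax t tt k /strip_edgeP[t0 [k' [t0s e1 e2]]].
have ek : k' = k.
  by rewrite -(tricycle_col k' (strip_tricycle st t0s)) e1 (tricycle_col k tt).
rewrite {k'}ek in e1 e2; set a := t (k + 1 + 1); set x := t k; set y := t (k + 1).
have xy : edge x y := tricycle_edge k tt.
have ya : edge y a := tricycle_edge (k + 1) tt.
have ax : edge a x by have := tricycle_edge (k + 1 + 1) tt; rewrite Z3_add3.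
have Sxy : strip_edge s x y by apply/strip_edgeP; exists t0, k.
suff both : strip_edge s y a && strip_edge s a x.
  case/andP: both => Sya Sax j; case: (Z3_cases k j) => -> //.
  by rewrite Z3_add3.
have nod (u h w : G) : strip_edge s u h -> strip_edge s h w -> edge w u -> strip_edge s w u.
  move=> uh hw wu; apply: contraT => nwu.
  by have [H [dH cH]] := strip_diwheel hcol st uh hw wu nwu; case: (nodiwheel dH cH).
have [[z [zs zk]]|new] := pselect (exists z : triple, z \in s /\ z (k + 1 + 1) = a); last first.
  have tt0 : agree_off (k + 1 + 1) t t0.
    apply/agree_offP => j; case: (Z3_cases k j) => -> //.
    by rewrite eqxx.
  have [|[s' st' lt]|[H [bH cH]]] := strip_extend hcyc hcol st t0s tt tt0.
  - by move=> z zs; apply/eqP => e; apply: new; exists z.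
  - by have := smax s' st'; rewrite leqNgt lt.
  - by case: (nobrancher bH cH).
(* If only one of the two edges is missing, [nod] gives it; if both are, then
   the paths of the strip that return along them have length two and close up to
   a directed cycle of length six. *)
case Sya : (strip_edge s y a); first by rewrite (nod x y a Sxy Sya ax).
case Sax : (strip_edge s a x); first by rewrite (nod a x y Sax Sxy ya) in Sya.
have [xW yW] := andP (strip_edge_verts Sxy).
have aW : a \in strip_verts s by apply/strip_vertsP; exists z, (k + 1 + 1).
have con := strip_connected st; have sub := strip_edge_sub st.
have [b ab by_] := return_edges hcyc ya sub (con _ _ aW yW).
have [d xd da] := return_edges hcyc ax sub (con _ _ xW aW).
have Sc1 : strip_edge s y (t0 (k + 1 + 1)).
  by rewrite /y -e2; exact: strip_edge_at.
have Sc2 : strip_edge s (t0 (k + 1 + 1)) x.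
  by rewrite /x -e1 -{2}(Z3_add3 k); exact: strip_edge_at.
have cx : col x = k by exact: tricycle_col.
have cy : col y = k + 1 by exact: tricycle_col.
have ca : col a = k + 1 + 1 by exact: tricycle_col.
have cc : col (t0 (k + 1 + 1)) = k + 1 + 1 by rewrite (hcol (sub _ _ Sc1)) cy.
have cd : col d = k + 1 by rewrite (hcol (sub _ _ xd)) cx.
have cb : col b = k by rewrite (hcol (sub _ _ ab)) ca Z3_add3.
have dif u v : col u != col v -> u != v by apply: contra => /eqP->.
(* If two vertices of the same colour coincided, one of the two missing edges would be on the
   strip. *)
have ne1 : y != d by apply: contraFneq Sya => ->.
have ne2 : t0 (k + 1 + 1) != a by apply: contraFneq Sya => <-.
have ne3 : x != b by apply: contraFneq Sax => ->.
have := no_hexagon hcyc (sub _ _ Sc1) (sub _ _ Sc2) (sub _ _ xd) (sub _ _ da) (sub _ _ ab) (sub _ _ by_).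
case/negP; rewrite /= !inE !negb_or ne1 ne2 ne3.
by rewrite !dif //= ?cx ?cy ?ca ?cc ?cd ?cb ?Z3_neq1 ?Z3_neq2 // eq_sym ?Z3_neq1 ?Z3_neq2.
Qed.

Hypothesis hG : unbreakable G.

Lemma sufficient_order (R : realType) : exists pos : G -> R, annular_order col pos.
Proof.
have [[_ con] [G3 _ _]] := hG.
have [t tt] : exists t, tricycle col t.
  have [u [v uv]] : exists u v : G, u != v.
    move: G3; rewrite cardE; case E: (enum G) (enum_uniq G) => [|a [|b l]] //=.
    by rewrite inE negb_or -andbA => /andP[ab _] _; exists a, b.
  have /connectP[[|w p] /=] := con u v; first by move=> _ e; rewrite e eqxx in uv.
  move=> /andP[uw _] _.
  have [z wz zu] := return_edges hcyc uw (fun _ _ h => h) (con w u).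
  by exists (triple_at (col u) u w z); exact: tricycle_at.
have t1 : strip col [:: t].
  by apply: (@strip_cons _ _ 0) => //; [split=> // -[|? [|]]|exact: agree_offxx].
have ex : exists n, `[< exists2 s, strip col s & size s = n >].
  by exists 1%N; apply/asboolP; exists [:: t].
(* The tricycles of a strip are distinct, so lengths are bounded and a longest strip exists. *)
have bound n : `[< exists2 s, strip col s & size s = n >] -> (n <= #|{: triple}|)%N.
  by move=> /asboolP[s st <-]; rewrite -(card_uniqP (strip_uniq st)) max_card.
case: (ex_maxnP ex bound) => n /asboolP[s st sn] nmax.
have smax s' : strip col s' -> (size s' <= size s)%N.
  by move=> st'; rewrite sn; apply: nmax; apply/asboolP; exists s'.
have [t0 t0s] : exists t0, t0 \in s.
  by have := smax _ t1; case: (s) => // a l _; exists a; exact: mem_head.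
have cl := max_strip_closed st smax.
have v0 : t0 0 \in strip_verts s by apply/strip_vertsP; exists t0, 0.
have v1 : t0 1 \in strip_verts s by apply/strip_vertsP; exists t0, 1.
have tt0 := strip_tricycle st t0s.
have n01 : t0 0 != t0 1.
  by apply/eqP => e; have := tricycle_col 0 tt0; rewrite e (tricycle_col 1 tt0).
have span := closed_subgraph_spans hcyc hcol (strip_edge_sub st) (@strip_edge_verts _ s)
  (strip_connected st) cl hG v0 v1 n01.
have full := closed_subgraph_full hcyc hcol (strip_edge_sub st) (@strip_edge_verts _ s)
  (strip_connected st) cl hG v0 v1 n01.
(* The rank of [v] is the place of the first tricycle that contains it. The successor makes
   positions positive, [span] makes ranks injective on each colour, and [full] with [strip_mono]
   gives monotonicity. *)
pose rk v := index v [seq z (col v) | z : triple <- s].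
exists (fun v => (rk v).+1%:R); split=> //.
- move=> u v cuv /eqP; rewrite eqr_nat eqSS /rk cuv => /eqP e.
  have mem w : col w = col v -> w \in [seq z (col v) | z : triple <- s].
    move=> <-; have /strip_vertsP[z [k [zs zk]]] := span w.
    apply/mapP; exists z => //; rewrite -zk.
    by rewrite (tricycle_col k (strip_tricycle st zs)).
  by rewrite -(nth_index u (mem u cuv)) e nth_index // mem.
- move=> u v u' v' uv u'v' cuu'; rewrite ltr_nat ler_nat !ltnS /rk.
  have /strip_edgeP[z [k [zs zu zv]]] := full _ _ uv.
  have /strip_edgeP[z' [k' [z's zu' zv']]] := full _ _ u'v'.
  have ck m y : y \in s -> col (y m) = m.
    by move=> ys; exact: tricycle_col (strip_tricycle st ys).
  have kk : k' = k by rewrite -(ck k z) // -(ck k' z') // zu zu' cuu'.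
  rewrite kk in zu' zv'; rewrite -zu -zu' -zv -zv' !ck //.
  exact: (strip_mono (k + 1) st zs z's).
Qed.

End Sufficiency.

Theorem mainTheorem4 (R : realType) (G : digraph)
    (hG : unbreakable G) (hcyc : three_cyclic G) :
  three_annular R G <->
  (forall H : digraph, is_diwheel H -> ~ contains G H) /\
  (forall H : digraph, is_brancher H -> ~ contains G H).
Proof.
split=> [/three_annular_order[col [pos O]]|[nodiwheel nobrancher]].
  split=> H; last exact: brancher_no_order O.
  by move=> dH /(annular_order_contains O)[c [p]]; exact: diwheel_no_order.
have [col hcol] := three_coloring hcyc (proj1 hG).
have [pos O] := sufficient_order hcyc nodiwheel nobrancher hcol hG R.
exact: order_three_annular O.
Qed.
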